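(* Let $c\geq 1$, let $\mathbb{F}$ be a field, and let $A$ and $B$ be $c$-nilpotent Lazard Lie algebras over $\mathbb{F}$ with a common sub-LLA $C$. Let $L'=(\overline{L}/Q)/P_{c+1}$ be the $c$-nilpotent LLA obtained by the construction described in the context from the family $L_1=A$, $L_2=B$ (so $I=\{1,2\}$) and $L_*=C$, where the distinguished subalgebras of $L'$ are the images of $P_i$, $1\leq i\leq c+1$. Then there is an isomorphism of LLAs $L'\cong A\otimes_C B$, where $A\otimes_C B$ is the free amalgam of $A$ and $B$ over $C$.
   Context: **LLAs.** A $c$-nilpotent Lazard Lie algebra ($c$-LLA, LLA) over $\mathbb{F}$ is a Lie algebra $L$ over $\mathbb{F}$ with a chain of distinguished subalgebras $L=P_1(L)\geq\cdots\geq P_{c+1}(L)=0$ with $[P_i(L),P_j(L)]\leq P_{i+j}(L)$ for all $i,j$, where $P_k(L)=0$ for $k>c$. LLA homomorphisms are Lie algebra homomorphisms $f:L\to M$ with $f(P_i(L))\subseteq P_i(M)$; LLA embeddings are injective and satisfy $a\in P_i(L)\iff f(a)\in P_i(M)$. A sub-LLA is a subalgebra $L_*\leq L$ with $P_i(L_* )=L_*\cap P_i(L)$. For nonzero $b\in L$, $\mathrm{lev}(b)$ is the maximal $i$ with $b\in P_i(L)$. A Malcev basis of $L$ is a vector space basis $b$ of $L$ such that for each $i$, $P_i(L)$ is the span of the elements of $b$ lying in $P_i(L)$. **Free amalgam.** Let $f_0:C\to A$, $g_0:C\to B$ be LLA embeddings. An LLA $S$ is a free amalgam of $A$ and $B$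 over $C$ if: (1) there are LLA embeddings $f_1:A\to S$, $g_1:B\to S$ with $f_1\circ f_0=g_1\circ g_0$; (2) $S$ is generated by $f_1(A)\cup g_1(B)$; (3) $f_1(A)\cap g_1(B)=(f_1\circ f_0)(C)$; (4) for every LLA $D$ and LLA homomorphisms $f:A\to D$, $g:B\to D$ with $f\circ f_0=g\circ g_0$ there is a unique LLA homomorphism $h:S\to D$ with $h\circ f_1=f$, $h\circ g_1=g$. It exists (by earlier work), is unique up to isomorphism, and is denoted $A\otimes_C B$ (here with $f_0,g_0$ the inclusions). **Regular words.** Let $S$ be a totally ordered set and order the associative words $S^*$ lexicographically. A word $w$ is regular if whenever $w=uv$ with $u,v$ non-empty, $w>vu$. The canonical bracketing $[w]$ of a regular word is defined by $[w]=w$ if $w\in S$, and otherwise $[w]=[[u],[v]]$ where $w=uv$ and $v$ is the longest proper regular suffix of $w$ (then $u$ is regular). The canonical bracketings of regular words form a basis of the free Lie algebra on $S$. **Construction.** Let $(L_\alpha)_{\alpha\in I}$ be $c$-LLAs over $\mathbb{F}$ with a common sub-LLA $L_*$. Choose a Malcev basis $(e_\beta)_{\beta\in J}$ of $L_*$, put $e_{\alpha,\beta}=e_\beta$ for $\beta\in J$, and extend $(e_{\alpha,\beta})_{\beta\in J}$ to a Malcev basis $(e_{\alpha,\beta})_{\beta\in J_\alpha}$ of $L_\alpha$, with $J\subseteq J_\alpha$ and the $J_\alpha$ disjoint over $J$. Choose a total order on $I$ and total orders $<_{J_\alpha}$ on $J_\alpha$ extending a common order on $J$, with every element of $J$ below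 every element of $J_\alpha\setminus J$. Let $S=\{f_{\alpha,\beta}:\alpha\in I,\beta\in J_\alpha\}$ be formal symbols, with $f_{\alpha,\beta}=f_{\alpha',\beta}$ exactly when $\beta\in J$ or $\alpha=\alpha'$. Order $S$ as follows: the symbols with $\beta\in J$ come first, ordered as $J$; the symbols $f_{\alpha,\beta}$ with $\beta\in J_\alpha\setminus J$ come next, ordered lexicographically (first by $\alpha$, then by $\beta$ in $<_{J_\alpha}$). Let $\overline{L}$ be the free Lie algebra over $\mathbb{F}$ on $S$ and let $Q$ be the ideal generated by all $[f_{\alpha,\beta},f_{\alpha,\gamma}]-\sum_{\delta\in J_\alpha}\lambda_\delta f_{\alpha,\delta}$, for $\alpha\in I$ and $\beta<_{J_\alpha}\gamma$ in $J_\alpha$, where $[e_{\alpha,\beta},e_{\alpha,\gamma}]=\sum_{\delta}\lambda_\delta e_{\alpha,\delta}$ in $L_\alpha$. A regular word (or its canonical bracketing) is special if the associative word contains no subword $f_{\alpha,\beta}f_{\alpha,\beta'}$ with $\beta>_{J_\alpha}\beta'$. By a theorem of Shirshov, the images of the canonical bracketings of the special regular words form a basis of $\overline{L}/Q$. Define $\mathrm{lev}(f_{\alpha,\beta})=\mathrm{lev}(e_{\alpha,\beta})$ (level computed in $L_\alpha$), $\mathrm{lev}(a_1\cdots a_n)=\sum_i\mathrm{lev}(a_i)$ for a word in $S^*$, and let the level of the basis element of $\overline{L}/Q$ given by a special regular word $v$ be $\mathrm{lev}(v)$. For $i\geq 1$ let $P_i\subseteq\overline{L}/Q$ be the span of the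 basis elements given by special regular words $v$ with $\mathrm{lev}(v)\geq i$. These satisfy $[P_n,P_m]\leq P_{n+m}$, so each $P_i$ is an ideal. Put $L'=(\overline{L}/Q)/P_{c+1}$, a $c$-LLA whose distinguished subalgebras are the images of $P_1,\ldots,P_{c+1}$. *)

(* Defs.v *)
From HB Require Import structures.
From mathcomp Require Import all_boot all_order all_algebra.
From mathcomp Require Import boolp classical_sets.

Set Implicit Arguments.
Unset Strict Implicit.
Unset Printing Implicit Defensive.

Import GRing.Theory.
Local Open Scope ring_scope.
Local Open Scope classical_set_scope.

HB.mixin Record Lmodule_isLie (F : fieldType) L of GRing.Lmodule F L := {
  lbr : L -> L -> L;
  lbr_linearl : forall a x y z, lbr (a *: x + y) z = a *: lbr x z + lbr y z;
  lbr_linearr : forall a x y z, lbr z (a *: x + y) = a *: lbr z x + lbr z y;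
  lbrxx : forall x, lbr x x = 0;
  lbr_jacobi : forall x y z,
    lbr x (lbr y z) + lbr y (lbr z x) + lbr z (lbr x y) = 0
}.

#[short(type="lieAlgType")]
HB.structure Definition LieAlgebra (F : fieldType) :=
  {L of Lmodule_isLie F L & GRing.Lmodule F L}.

Section LieBasics.
Variable F : fieldType.
Implicit Types L M : lieAlgType F.

Definition subspace (V : lmodType F) (X : set V) : Prop :=
  X 0 /\ forall a u v, X u -> X v -> X (a *: u + v).

Definition lie_subalgebra L (X : set L) : Prop :=
  subspace X /\ forall x y, X x -> X y -> X (lbr x y).

Definition lie_ideal L (X : set L) : Prop :=
  subspace X /\ forall x y, X y -> X (lbr x y).

Definition ideal_gen L (X : set L) : set L :=
  [set v | forall I : set L, lie_ideal I -> X `<=` I -> I v].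

Definition generates L (X : set L) : Prop :=
  forall Y : set L, lie_subalgebra Y -> X `<=` Y -> Y = setT.

Definition lie_morph L M (f : L -> M) : Prop :=
  forall x y, f (lbr x y) = lbr (f x) (f y).

Definition span (V : lmodType F) (X : set V) : set V :=
  [set v | exists (n : nat) (a : 'I_n -> F) (x : 'I_n -> V),
     (forall i, X (x i)) /\ v = \sum_i a i *: x i].

Definition lin_indep (V : lmodType F) (J : Type) (e : J -> V) : Prop :=
  forall (n : nat) (j : 'I_n -> J) (a : 'I_n -> F), injective j ->
    \sum_i a i *: e (j i) = 0 -> forall i, a i = 0.

Definition is_basis (V : lmodType F) (J : Type) (e : J -> V) : Prop :=
  lin_indep e /\ span (range e) = setT.

Lemma ideal_gen_ideal L (X : set L) : lie_ideal (ideal_gen X).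
Proof.
split; first split.
- by move=> I [[]].
- move=> a u v hu hv I hI hX; move: (hI) => [[_ h] _].
  by apply: h; [apply: hu | apply: hv].
- by move=> x y hy I hI hX; move: (hI) => [_]; apply; apply: hy.
Qed.

Lemma sub_ideal_gen L (X : set L) : X `<=` ideal_gen X.
Proof. by move=> x Xx I _; apply. Qed.

Lemma ideal_gen_id L (X : set L) : lie_ideal X -> ideal_gen X = X.
Proof. by move=> hX; apply/seteqP; split=> x; [apply | apply: sub_ideal_gen]. Qed.

End LieBasics.

(* Both the free Lie algebra (Lie terms modulo the Lie algebra axioms) and
   the quotient by an ideal are instances of this. *)

Record lie_setoid (F : fieldType) := LieSetoid {
  ls_car : Type;
  ls_eq : ls_car -> ls_car -> Prop;
  ls_zero : ls_car;
  ls_opp : ls_car -> ls_car;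
  ls_add : ls_car -> ls_car -> ls_car;
  ls_scale : F -> ls_car -> ls_car;
  ls_lbr : ls_car -> ls_car -> ls_car;
  ls_refl : forall x, ls_eq x x;
  ls_sym : forall x y, ls_eq x y -> ls_eq y x;
  ls_trans : forall x y z, ls_eq x y -> ls_eq y z -> ls_eq x z;
  ls_oppC : forall x x', ls_eq x x' -> ls_eq (ls_opp x) (ls_opp x');
  ls_addC : forall x x' y y', ls_eq x x' -> ls_eq y y' ->
    ls_eq (ls_add x y) (ls_add x' y');
  ls_scaleC : forall a x x', ls_eq x x' -> ls_eq (ls_scale a x) (ls_scale a x');
  ls_lbrC : forall x x' y y', ls_eq x x' -> ls_eq y y' ->
    ls_eq (ls_lbr x y) (ls_lbr x' y');
  ls_addrA : forall x y z, ls_eq (ls_add x (ls_add y z)) (ls_add (ls_add x y) z);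
  ls_addrC : forall x y, ls_eq (ls_add x y) (ls_add y x);
  ls_add0r : forall x, ls_eq (ls_add ls_zero x) x;
  ls_addNr : forall x, ls_eq (ls_add (ls_opp x) x) ls_zero;
  ls_scalerA : forall a b x,
    ls_eq (ls_scale a (ls_scale b x)) (ls_scale (a * b) x);
  ls_scale1r : forall x, ls_eq (ls_scale 1 x) x;
  ls_scalerDr : forall a x y,
    ls_eq (ls_scale a (ls_add x y)) (ls_add (ls_scale a x) (ls_scale a y));
  ls_scalerDl : forall x a b,
    ls_eq (ls_scale (a + b) x) (ls_add (ls_scale a x) (ls_scale b x));
  ls_linearl : forall a x y z,
    ls_eq (ls_lbr (ls_add (ls_scale a x) y) z)
          (ls_add (ls_scale a (ls_lbr x z)) (ls_lbr y z));
  ls_linearr : forall a x y z,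
    ls_eq (ls_lbr z (ls_add (ls_scale a x) y))
          (ls_add (ls_scale a (ls_lbr z x)) (ls_lbr z y));
  ls_lbrxx : forall x, ls_eq (ls_lbr x x) ls_zero;
  ls_jacobi : forall x y z,
    ls_eq (ls_add (ls_add (ls_lbr x (ls_lbr y z)) (ls_lbr y (ls_lbr z x)))
                  (ls_lbr z (ls_lbr x y))) ls_zero
}.

Section SetoidQuotient.
Variables (F : fieldType) (X : lie_setoid F).

Local Notation T := {classic (ls_car X)}.

Definition lsq_rel : rel T := fun x y => `[< @ls_eq F X x y >].

Lemma lsq_relP (x y : T) : reflect (@ls_eq F X x y) (lsq_rel x y).
Proof. exact: asboolP. Qed.

Lemma lsq_equiv_class : equiv_class_of lsq_rel.
Proof.
split=> [x | x y | y x z]; first exact/lsq_relP/ls_refl.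
  by apply/lsq_relP/lsq_relP=> h; apply: ls_sym.
by move=> /lsq_relP h1 /lsq_relP h2; apply/lsq_relP; apply: (ls_trans h1 h2).
Qed.

Canonical lsq_equiv := EquivRelPack lsq_equiv_class.

Definition lsq : Type := {eq_quot lsq_equiv}%qT.
HB.instance Definition _ := Choice.on lsq.

Definition lsq_pi (x : ls_car X) : lsq := \pi_({eq_quot lsq_equiv})%qT (x : T).
Definition lsq_repr (q : lsq) : ls_car X := repr (q : {eq_quot lsq_equiv}%qT).

Lemma lsq_reprK q : lsq_pi (lsq_repr q) = q.
Proof. exact: reprK. Qed.

Lemma lsq_piP x y : lsq_pi x = lsq_pi y <-> ls_eq x y.
Proof.
split=> [/eqmodP /lsq_relP // | h].
by apply/eqmodP/lsq_relP.
Qed.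

Lemma lsq_piK x : ls_eq (lsq_repr (lsq_pi x)) x.
Proof. by apply/lsq_piP; rewrite lsq_reprK. Qed.

Let zero : lsq := lsq_pi (ls_zero X).
Let opp (x : lsq) : lsq := lsq_pi (ls_opp (lsq_repr x)).
Let add (x y : lsq) : lsq := lsq_pi (ls_add (lsq_repr x) (lsq_repr y)).
Let scale a (x : lsq) : lsq := lsq_pi (ls_scale a (lsq_repr x)).
Let br (x y : lsq) : lsq := lsq_pi (ls_lbr (lsq_repr x) (lsq_repr y)).

Let oppE x : opp (lsq_pi x) = lsq_pi (ls_opp x).
Proof. exact/lsq_piP/ls_oppC/lsq_piK. Qed.
Let addE x y : add (lsq_pi x) (lsq_pi y) = lsq_pi (ls_add x y).
Proof. by apply/lsq_piP/ls_addC; apply: lsq_piK. Qed.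
Let scaleE a x : scale a (lsq_pi x) = lsq_pi (ls_scale a x).
Proof. exact/lsq_piP/ls_scaleC/lsq_piK. Qed.
Let brE x y : br (lsq_pi x) (lsq_pi y) = lsq_pi (ls_lbr x y).
Proof. by apply/lsq_piP/ls_lbrC; apply: lsq_piK. Qed.
Let EE := (oppE, addE, scaleE, brE).

Let addA : associative add.
Proof.
move=> x y z; rewrite -(lsq_reprK x) -(lsq_reprK y) -(lsq_reprK z) !EE.
exact/lsq_piP/ls_addrA.
Qed.
Let addC : commutative add.
Proof.
move=> x y; rewrite -(lsq_reprK x) -(lsq_reprK y) !EE.
exact/lsq_piP/ls_addrC.
Qed.
Let add0 : left_id zero add.
Proof. by move=> x; rewrite -(lsq_reprK x) !EE; apply/lsq_piP/ls_add0r. Qed.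
Let addN : left_inverse zero opp add.
Proof. by move=> x; rewrite -(lsq_reprK x) !EE; apply/lsq_piP/ls_addNr. Qed.

HB.instance Definition _ := GRing.isZmodule.Build lsq addA addC add0 addN.

Let scaleA a b x : scale a (scale b x) = scale (a * b) x.
Proof. by rewrite -(lsq_reprK x) !EE; apply/lsq_piP/ls_scalerA. Qed.
Let scale1 : left_id 1 scale.
Proof. by move=> x; rewrite -(lsq_reprK x) !EE; apply/lsq_piP/ls_scale1r. Qed.
Let scaleDr : right_distributive scale add.
Proof.
move=> a x y; rewrite -(lsq_reprK x) -(lsq_reprK y) !EE.
exact/lsq_piP/ls_scalerDr.
Qed.
Let scaleDl x : {morph scale^~ x : a b / a + b >-> add a b}.
Proof. by move=> a b; rewrite -(lsq_reprK x) !EE; apply/lsq_piP/ls_scalerDl. Qed.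

HB.instance Definition _ :=
  GRing.Zmodule_isLmodule.Build F lsq scaleA scale1 scaleDr scaleDl.

Let brl a (x y z : lsq) : br (a *: x + y) z = a *: br x z + br y z.
Proof.
change (br (add (scale a x) y) z = add (scale a (br x z)) (br y z)).
rewrite -(lsq_reprK x) -(lsq_reprK y) -(lsq_reprK z) !EE.
exact/lsq_piP/ls_linearl.
Qed.
Let brr a (x y z : lsq) : br z (a *: x + y) = a *: br z x + br z y.
Proof.
change (br z (add (scale a x) y) = add (scale a (br z x)) (br z y)).
rewrite -(lsq_reprK x) -(lsq_reprK y) -(lsq_reprK z) !EE.
exact/lsq_piP/ls_linearr.
Qed.
Let brxx (x : lsq) : br x x = 0.
Proof.
by rewrite -(lsq_reprK x) brE; apply/lsq_piP/ls_lbrxx.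
Qed.
Let jac (x y z : lsq) : br x (br y z) + br y (br z x) + br z (br x y) = 0.
Proof.
change (add (add (br x (br y z)) (br y (br z x))) (br z (br x y)) = zero).
rewrite -(lsq_reprK x) -(lsq_reprK y) -(lsq_reprK z) !EE.
exact/lsq_piP/ls_jacobi.
Qed.

HB.instance Definition _ := Lmodule_isLie.Build F lsq brl brr brxx jac.

Lemma lsq_pi0 : lsq_pi (ls_zero X) = 0. Proof. by []. Qed.
Lemma lsq_piN x : lsq_pi (ls_opp x) = - lsq_pi x. Proof. by rewrite -oppE. Qed.
Lemma lsq_piD x y : lsq_pi (ls_add x y) = lsq_pi x + lsq_pi y.
Proof. by rewrite -addE. Qed.
Lemma lsq_piZ a x : lsq_pi (ls_scale a x) = a *: lsq_pi x.
Proof. by rewrite -scaleE. Qed.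
Lemma lsq_pi_lbr x y : lsq_pi (ls_lbr x y) = lbr (lsq_pi x) (lsq_pi y).
Proof. by rewrite -brE. Qed.

End SetoidQuotient.

Section FreeLie.
Variables (F : fieldType) (S : Type).

Inductive lterm : Type :=
| LVar of S
| LZero
| LOpp of lterm
| LAdd of lterm & lterm
| LScale of F & lterm
| LBr of lterm & lterm.

Inductive lterm_eq : lterm -> lterm -> Prop :=
| LErefl x : lterm_eq x x
| LEsym x y : lterm_eq x y -> lterm_eq y x
| LEtrans x y z : lterm_eq x y -> lterm_eq y z -> lterm_eq x z
| LEopp x x' : lterm_eq x x' -> lterm_eq (LOpp x) (LOpp x')
| LEadd x x' y y' :
    lterm_eq x x' -> lterm_eq y y' -> lterm_eq (LAdd x y) (LAdd x' y')
| LEscale a x x' : lterm_eq x x' -> lterm_eq (LScale a x) (LScale a x')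
| LEbr x x' y y' :
    lterm_eq x x' -> lterm_eq y y' -> lterm_eq (LBr x y) (LBr x' y')
| LEaddA x y z : lterm_eq (LAdd x (LAdd y z)) (LAdd (LAdd x y) z)
| LEaddC x y : lterm_eq (LAdd x y) (LAdd y x)
| LEadd0 x : lterm_eq (LAdd LZero x) x
| LEaddN x : lterm_eq (LAdd (LOpp x) x) LZero
| LEscaleA a b x : lterm_eq (LScale a (LScale b x)) (LScale (a * b) x)
| LEscale1 x : lterm_eq (LScale 1 x) x
| LEscaleDr a x y :
    lterm_eq (LScale a (LAdd x y)) (LAdd (LScale a x) (LScale a y))
| LEscaleDl x a b :
    lterm_eq (LScale (a + b) x) (LAdd (LScale a x) (LScale b x))
| LElinearl a x y z :
    lterm_eq (LBr (LAdd (LScale a x) y) z) (LAdd (LScale a (LBr x z)) (LBr y z))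
| LElinearr a x y z :
    lterm_eq (LBr z (LAdd (LScale a x) y)) (LAdd (LScale a (LBr z x)) (LBr z y))
| LEbrxx x : lterm_eq (LBr x x) LZero
| LEjacobi x y z :
    lterm_eq (LAdd (LAdd (LBr x (LBr y z)) (LBr y (LBr z x))) (LBr z (LBr x y)))
             LZero.

Definition lterm_setoid : lie_setoid F :=
  LieSetoid LErefl LEsym LEtrans LEopp LEadd LEscale LEbr LEaddA LEaddC LEadd0
    LEaddN LEscaleA LEscale1 LEscaleDr LEscaleDl LElinearl LElinearr LEbrxx
    LEjacobi.

Definition free_lie : lieAlgType F := lsq lterm_setoid.

Definition free_gen (s : S) : free_lie := lsq_pi (X := lterm_setoid) (LVar s).

Section UniversalProperty.
Variables (M : lieAlgType F) (phi : S -> M).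

Fixpoint lterm_eval (t : lterm) : M :=
  match t with
  | LVar s => phi s
  | LZero => 0
  | LOpp t => - lterm_eval t
  | LAdd t u => lterm_eval t + lterm_eval u
  | LScale a t => a *: lterm_eval t
  | LBr t u => lbr (lterm_eval t) (lterm_eval u)
  end.

Lemma lterm_eval_eq t u : lterm_eq t u -> lterm_eval t = lterm_eval u.
Proof.
elim=> //= *; try congruence.
- exact: addrA.
- exact: addrC.
- exact: add0r.
- exact: addNr.
- exact: scalerA.
- exact: scale1r.
- exact: scalerDr.
- exact: scalerDl.
- exact: lbr_linearl.
- exact: lbr_linearr.
- exact: lbrxx.
- exact: lbr_jacobi.
Qed.

Lemma free_lie_universal :
  exists h : {linear free_lie -> M},
    [/\ lie_morph h, forall s, h (free_gen s) = phi s
      & forall h' : {linear free_lie -> M}, lie_morph h' ->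
          (forall s, h' (free_gen s) = phi s) -> h' =1 h].
Proof.
pose h (x : free_lie) := lterm_eval (lsq_repr x).
have hE t : h (lsq_pi (X := lterm_setoid) t) = lterm_eval t.
  by apply: lterm_eval_eq; apply: (lsq_piK (X := lterm_setoid)).
have hlin : linear h.
  move=> a x y; rewrite -(lsq_reprK x) -(lsq_reprK y).
  by rewrite -lsq_piZ -lsq_piD !hE.
pose hL := GRing.isLinear.Build F free_lie M _ h hlin.
pose H : {linear free_lie -> M} := HB.pack h hL.
exists H; split=> [x y | s | h' hbr hgen x]; rewrite /H /=.
- by rewrite -(lsq_reprK x) -(lsq_reprK y) -lsq_pi_lbr !hE.
- by rewrite /free_gen hE.
- rewrite -(lsq_reprK x) hE; elim: (lsq_repr x) => //=.
  + by rewrite lsq_pi0 raddf0.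
  + by move=> t <-; rewrite lsq_piN raddfN.
  + by move=> t <- u <-; rewrite lsq_piD raddfD.
  + by move=> a t <-; rewrite lsq_piZ linearZ.
  + by move=> t <- u <-; rewrite lsq_pi_lbr hbr.
Qed.

End UniversalProperty.
End FreeLie.

Section LieQuotient.
Variables (F : fieldType) (L : lieAlgType F) (X : set L).

Let I := ideal_gen X.
Let eqI (x y : L) : Prop := I (x - y).

Let I0 : I 0. Proof. by case: (ideal_gen_ideal X) => [[]]. Qed.
Let IZD a u v : I u -> I v -> I (a *: u + v).
Proof. by case: (ideal_gen_ideal X) => [[_ h] _]; apply: h. Qed.
Let IZ a u : I u -> I (a *: u).
Proof. by move=> hu; rewrite -[_ *: _]addr0; apply: IZD. Qed.
Let ID u v : I u -> I v -> I (u + v).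
Proof. by move=> hu hv; rewrite -[u]scale1r; apply: IZD. Qed.
Let IN u : I u -> I (- u).
Proof. by move=> hu; rewrite -scaleN1r; apply: IZ. Qed.
Let Ibr x y : I y -> I (lbr x y).
Proof. by case: (ideal_gen_ideal X) => [_]; apply. Qed.

Let lbrC (x y : L) : lbr x y = - lbr y x.
Proof.
have D1 (u v w : L) : lbr (u + v) w = lbr u w + lbr v w.
  by have := lbr_linearl 1 u v w; rewrite !scale1r.
have D2 (u v w : L) : lbr w (u + v) = lbr w u + lbr w v.
  by have := lbr_linearr 1 u v w; rewrite !scale1r.
have := lbrxx (x + y); rewrite D1 !D2 !lbrxx add0r addr0.
by move/eqP; rewrite addr_eq0 => /eqP.
Qed.

Let Eeq x y : x = y -> eqI x y. Proof. by move=> ->; rewrite /eqI subrr. Qed.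
Let Erefl x : eqI x x. Proof. exact: Eeq. Qed.
Let Esym x y : eqI x y -> eqI y x.
Proof. by move=> /IN; rewrite opprB. Qed.
Let Etrans x y z : eqI x y -> eqI y z -> eqI x z.
Proof. by move=> h1 h2; have := ID h1 h2; rewrite addrA subrK. Qed.
Let Eopp x x' : eqI x x' -> eqI (- x) (- x').
Proof. by move=> /IN; rewrite opprD. Qed.
Let Eadd x x' y y' : eqI x x' -> eqI y y' -> eqI (x + y) (x' + y').
Proof. by move=> h1 h2; rewrite /eqI opprD addrACA; apply: ID. Qed.
Let Escale a x x' : eqI x x' -> eqI (a *: x) (a *: x').
Proof. by move=> h; rewrite /eqI -scalerBr; apply: IZ. Qed.
Let Ebrr x y y' : eqI y y' -> eqI (lbr x y) (lbr x y').
Proof.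
move=> h; rewrite /eqI; have -> : lbr x y - lbr x y' = lbr x (y - y').
  by rewrite [y - y']addrC -[- y']scaleN1r lbr_linearr scaleN1r addrC.
exact: Ibr.
Qed.
Let Ebr x x' y y' : eqI x x' -> eqI y y' -> eqI (lbr x y) (lbr x' y').
Proof.
move=> h1 h2; apply: (Etrans (Ebrr x h2)).
by rewrite (lbrC x) (lbrC x'); apply: Eopp; apply: Ebrr.
Qed.

Definition lie_quot_setoid : lie_setoid F :=
  LieSetoid (ls_zero := 0) Erefl Esym Etrans Eopp Eadd Escale Ebr
    (fun x y z => Eeq (addrA x y z)) (fun x y => Eeq (addrC x y))
    (fun x => Eeq (add0r x)) (fun x => Eeq (addNr x))
    (fun a b x => Eeq (scalerA a b x)) (fun x => Eeq (scale1r x))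
    (fun a x y => Eeq (scalerDr a x y)) (fun x a b => Eeq (scalerDl x a b))
    (fun a x y z => Eeq (lbr_linearl a x y z))
    (fun a x y z => Eeq (lbr_linearr a x y z))
    (fun x => Eeq (lbrxx x)) (fun x y z => Eeq (lbr_jacobi x y z)).

Definition lie_quot : lieAlgType F := lsq lie_quot_setoid.

Definition lie_pi (x : L) : lie_quot := lsq_pi (X := lie_quot_setoid) x.

Lemma lie_pi_is_linear : linear lie_pi.
Proof.
move=> a x y; rewrite /lie_pi.
by rewrite -(lsq_piZ (X := lie_quot_setoid)) -(lsq_piD (X := lie_quot_setoid)).
Qed.
HB.instance Definition _ :=
  GRing.isLinear.Build F L lie_quot _ lie_pi lie_pi_is_linear.

Lemma lie_pi_lbr : lie_morph lie_pi.
Proof. by move=> x y; apply: (lsq_pi_lbr (X := lie_quot_setoid)). Qed.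

Lemma lie_pi_surj (q : lie_quot) : exists x, lie_pi x = q.
Proof. by exists (lsq_repr q); apply: lsq_reprK. Qed.

Lemma lie_pi_eq0 x : lie_pi x = 0 <-> ideal_gen X x.
Proof.
rewrite -(raddf0 lie_pi) /lie_pi (lsq_piP (X := lie_quot_setoid)) /= /eqI.
by rewrite subr0.
Qed.

End LieQuotient.

(* A Lie algebra with a family of subsets; only the indices i >= 1 of [dist]
   are meaningful, [dist 0] is never used. *)
Record filtLie (F : fieldType) := FiltLie {
  fl_lie :> lieAlgType F;
  dist : nat -> set fl_lie
}.

Arguments dist {F} L i : rename.

Record is_LLA (F : fieldType) (c : nat) (L : filtLie F) : Prop := IsLLA {
  dist_subalg : forall i, (0 < i)%N -> lie_subalgebra (dist L i);
  dist1 : dist L 1 = setT;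
  dist_desc : forall i, (0 < i)%N -> dist L i.+1 `<=` dist L i;
  dist_lbr : forall i j x y, (0 < i)%N -> (0 < j)%N ->
    dist L i x -> dist L j y -> dist L (i + j)%N (lbr x y);
  dist_nil : forall k, (c < k)%N -> dist L k = [set 0]
}.

Record LLA (F : fieldType) (c : nat) := MkLLA {
  LLA_filt :> filtLie F;
  LLA_axioms : is_LLA c LLA_filt
}.

Section LLADefs.
Variable F : fieldType.

Definition LLA_hom (L M : filtLie F) (f : {linear L -> M}) : Prop :=
  lie_morph f /\ forall i x, (0 < i)%N -> dist L i x -> dist M i (f x).

Definition LLA_emb (L M : filtLie F) (f : {linear L -> M}) : Prop :=
  [/\ lie_morph f, injective f
    & forall i x, (0 < i)%N -> (dist L i x <-> dist M i (f x))].

Definition LLA_iso (L M : filtLie F) : Prop :=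
  exists f : {linear L -> M}, LLA_emb f /\ bijective f.

Definition malcev_basis (L : filtLie F) (J : Type) (e : J -> L) : Prop :=
  is_basis e /\
  forall i, (0 < i)%N -> dist L i = span [set x | range e x /\ dist L i x].

(* The maximal i with [dist L i x], when x is a nonzero element of a c-LLA. *)
Definition lev (c : nat) (L : filtLie F) (x : L) : nat :=
  \max_(1 <= i < c.+1 | `[< dist L i x >]) i.

Lemma lev_emb (c : nat) (L M : filtLie F) (f : {linear L -> M}) (x : L) :
  LLA_emb f -> lev c (f x) = lev c x.
Proof.
move=> [_ _ hf]; rewrite /lev big_nat_cond [RHS]big_nat_cond.
apply: eq_bigl => i; case: (ltnP 0 i) => //= i0; congr (_ && _).
by apply/asboolP/asboolP => /(hf _ _ i0).
Qed.

Definition is_free_amalgam (c : nat) (A B C : LLA F c)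
    (f0 : {linear C -> A}) (g0 : {linear C -> B}) (S : LLA F c) : Prop :=
  exists (f1 : {linear A -> S}) (g1 : {linear B -> S}),
    [/\ [/\ LLA_emb f1, LLA_emb g1 & forall x, f1 (f0 x) = g1 (g0 x)],
        generates (range f1 `|` range g1),
        range f1 `&` range g1 = range (f1 \o f0)
      & forall (D : LLA F c) (f : {linear A -> D}) (g : {linear B -> D}),
          LLA_hom f -> LLA_hom g -> (forall x, f (f0 x) = g (g0 x)) ->
          exists h : {linear S -> D},
            [/\ LLA_hom h, forall x, h (f1 x) = f x, forall y, h (g1 y) = g y
              & forall h' : {linear S -> D},
                  LLA_hom h' -> (forall x, h' (f1 x) = f x) ->
                  (forall y, h' (g1 y) = g y) -> h' =1 h]].

End LLADefs.

Section RegularWords.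
Variables (S : Type) (lt : S -> S -> Prop).

Inductive lexlt : seq S -> seq S -> Prop :=
| LexNil y t : lexlt [::] (y :: t)
| LexHead x y s t : lt x y -> lexlt (x :: s) (y :: t)
| LexTail x s t : lexlt s t -> lexlt (x :: s) (x :: t).

(* The empty word is not regular. *)
Definition regular (w : seq S) : Prop :=
  w <> [::] /\
  forall u v, u <> [::] -> v <> [::] -> w = u ++ v -> lexlt (v ++ u) w.

(* In [w = u ++ v] the word v is the longest proper regular suffix of w. *)
Definition canonical_split (u v : seq S) : Prop :=
  [/\ u <> [::], regular v
    & forall u' v', u' <> [::] -> regular v' -> u ++ v = u' ++ v' ->
        (size v' <= size v)%N].

(* [bracketing gen w x]: x is the canonical bracketing [w], evaluated in L
   by sending each letter s to [gen s]. *)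
Inductive bracketing (F : fieldType) (L : lieAlgType F) (gen : S -> L) :
    seq S -> L -> Prop :=
| BrLetter s : bracketing gen [:: s] (gen s)
| BrSplit u v x y : canonical_split u v ->
    bracketing gen u x -> bracketing gen v y ->
    bracketing gen (u ++ v) (lbr x y).

End RegularWords.

Definition strict_total_order (T : Type) (lt : T -> T -> Prop) : Prop :=
  [/\ forall x, ~ lt x x,
      forall x y z, lt x y -> lt y z -> lt x z
    & forall x y, x <> y -> lt x y \/ lt y x].

Section Construction.
Variables (F : fieldType) (c : nat) (I : Type) (L : I -> LLA F c).
Variables (Ls : LLA F c) (iota : forall a, {linear Ls -> L a}).

(* The index set J_a is the disjoint union of J and K a; in particular the
   sets J_a are disjoint over J. *)
Definition ext_basis (J : Type) (K : I -> Type) (eJ : J -> Ls)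
    (eK : forall a, K a -> L a) (a : I) (b : J + K a) : L a :=
  match b with inl j => iota a (eJ j) | inr k => eK a k end.

Record choices := Choices {
  cJ : Type;
  cK : I -> Type;
  eJ : cJ -> Ls;
  eK : forall a, cK a -> L a;
  ltI : I -> I -> Prop;
  ltJ : cJ -> cJ -> Prop;
  ltK : forall a, cK a -> cK a -> Prop;
  eJ_malcev : malcev_basis eJ;
  e_malcev : forall a, malcev_basis (@ext_basis cJ cK eJ eK a);
  ltI_total : strict_total_order ltI;
  ltJ_total : strict_total_order ltJ;
  ltK_total : forall a, strict_total_order (@ltK a)
}.

Variable X : choices.

Definition idx (a : I) : Type := (cJ X + cK X a)%type.

Definition ebase (a : I) : idx a -> L a := @ext_basis (cJ X) (cK X) (@eJ X) (@eK X) a.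

Inductive lt_idx (a : I) : idx a -> idx a -> Prop :=
| LtIdxJJ j j' : ltJ j j' -> lt_idx (inl j) (inl j')
| LtIdxJK j k : lt_idx (inl j) (inr k)
| LtIdxKK k k' : ltK k k' -> lt_idx (inr k) (inr k').

Definition letter : Type := (cJ X + {a : I & cK X a})%type.

Definition fsym (a : I) (b : idx a) : letter :=
  match b with inl j => inl j | inr k => inr (existT _ a k) end.

Inductive lt_letter : letter -> letter -> Prop :=
| LtJJ j j' : ltJ j j' -> lt_letter (inl j) (inl j')
| LtJK j p : lt_letter (inl j) (inr p)
| LtII a a' (k : cK X a) (k' : cK X a') : ltI X a a' ->
    lt_letter (inr (existT _ a k)) (inr (existT _ a' k'))
| LtKK a (k k' : cK X a) : ltK k k' ->
    lt_letter (inr (existT _ a k)) (inr (existT _ a k')).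

(* For a letter from J the level may be computed in Ls: by [lev_emb] it is
   the same in every [L a]. *)
Definition lev_letter (s : letter) : nat :=
  match s with
  | inl j => lev c (eJ j)
  | inr (existT a k) => lev c (eK k)
  end.

Definition lev_word (w : seq letter) : nat := (\sum_(s <- w) lev_letter s)%N.

Definition special (w : seq letter) : Prop :=
  regular lt_letter w /\
  forall a (b b' : idx a) u v,
    w = u ++ [:: fsym b; fsym b'] ++ v -> ~ lt_idx b' b.

Definition Lbar : lieAlgType F := free_lie F letter.

Definition fbar (a : I) (b : idx a) : Lbar := free_gen F (fsym b).

Inductive Qrel : set Lbar :=
| QRel a (b g : idx a) (n : nat) (lam : 'I_n -> F) (d : 'I_n -> idx a) :
    lt_idx b g -> lbr (ebase b) (ebase g) = \sum_i lam i *: ebase (d i) ->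
    Qrel (lbr (fbar b) (fbar g) - \sum_i lam i *: fbar (d i)).

Definition LbarQ : lieAlgType F := lie_quot Qrel.

Definition PQ (i : nat) : set LbarQ :=
  span [set y | exists w x,
    [/\ special w, (i <= lev_word w)%N,
        bracketing lt_letter (@free_gen F letter) w x & y = lie_pi Qrel x]].

(* [lie_quot] divides by the ideal generated by its argument; P_{c+1} is an
   ideal, so this is the quotient by P_{c+1} itself ([ideal_gen_id]). *)
Definition Lprime : filtLie F :=
  FiltLie (fun i => @lie_pi F LbarQ (PQ c.+1) @` PQ i).

End Construction.

Arguments PQ {F c I L Ls iota} X i.

(* The family L_1 = A, L_2 = B, with [false] for the index 1 and [true] for 2. *)

Definition pair_fam (F : fieldType) (c : nat) (A B : LLA F c) (b : bool) :
  LLA F c := if b then B else A.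

Definition pair_incl (F : fieldType) (c : nat) (A B C : LLA F c)
    (f0 : {linear C -> A}) (g0 : {linear C -> B}) (b : bool) :
    {linear C -> pair_fam A B b} :=
  match b with true => g0 | false => f0 end.

(* Main.v *)
From HB Require Import structures.
From mathcomp Require Import all_boot all_order all_algebra.
From mathcomp Require Import boolp classical_sets.
Require Import Defs.

Set Implicit Arguments.
Unset Strict Implicit.
Unset Printing Implicit Defensive.

Import GRing.Theory.
Local Open Scope ring_scope.
Local Open Scope classical_set_scope.

(** The isomorphism with a free amalgam [T] comes from comparing universal
    properties. The linear maps from [A] and [B] to [L'] that send each basis
    vector to its letter are homomorphisms and agree on [C], so they glue to a
    map [T -> L']. Conversely, sending each letter to the basis vector it stands
    for kills the relations [Qrel], and it sends a bracketing of a word of level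
    [i] to level [i] of [T]; as [T] vanishes above level [c], it also kills
    [PQ X c.+1] and yields a map [L' -> T] ([Lprime_universal]). Both composites
    fix the generators, so they are identities.

    The first half of this argument needs [L'] to be an LLA, that is,
    [[PQ n, PQ m] <= PQ (n + m)] and [PQ 1 = setT]. This is the spanning half of
    Shirshov's theorem with a control on levels, and it is where the work lies.
    Reversing the order of the letters turns regular words into Lyndon words.
    Two rewriting facts hold in any Lie algebra with chosen images of the
    letters, [[w]] denoting the canonical bracketing:

    - [br_product]: for Lyndon words [u] below [v], [[[u],[v]]] is [[uv]] plus a
      combination of [[w]] for Lyndon rearrangements [w] of [uv] above [uv];

    - [br_has_adjacent]: if the Lyndon word [w] contains two adjacent letters
      [x], [y] whose bracket is a combination of letters of weight at least that
      of [xy], then [[w]] is a combination of [[w']] for Lyndon words [w'] that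
      are either shorter and at least as heavy, or rearrangements above [w].

    A word has finitely many rearrangements, so the second rewriting terminates:
    every canonical bracketing is a combination of special ones of no smaller
    level ([br_reduced]), and with the first rewriting so is every bracket of
    two of them ([reduced_lbr]). *)

(** * Lyndon words *)
Section WordOrder.
Context {S : Type} {lt : S -> S -> Prop} (ltO : strict_total_order lt).
Implicit Types (a b c s t u v w : seq S).

Local Lemma ltxx x : ~ lt x x. Proof. by case: ltO. Qed.
Local Lemma lttr x y z : lt x y -> lt y z -> lt x z.
Proof. by case: ltO => _ h _; apply: h. Qed.
Local Lemma lttot x y : x = y \/ lt x y \/ lt y x.
Proof.
by case: ltO => _ _ h; have [->|/h] := pselect (x = y); [left | right].
Qed.

(** Letters are compared in the reverse of [lt]: the regular words, which are
    greatest among their rotations, become the Lyndon words, which are least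
    among their suffixes. The relation [slt] asks for a disagreement at some
    letter, so it survives appending arbitrary words on the right; [llt] is the
    full lexicographic order, where a proper prefix comes first. *)
Fixpoint slt (lt : S -> S -> Prop) a b : Prop :=
  match a, b with
  | x :: a', y :: b' => lt y x \/ (x = y /\ slt lt a' b')
  | _, _ => False
  end.

Fixpoint llt (lt : S -> S -> Prop) a b : Prop :=
  match a, b with
  | _, [::] => False
  | [::], _ :: _ => True
  | x :: a', y :: b' => lt y x \/ (x = y /\ llt lt a' b')
  end.

Local Notation "a ≪ b" := (slt lt a b) (at level 70).
Local Notation "a ≺ b" := (llt lt a b) (at level 70).

Lemma slt_cat a b s t : a ≪ b -> a ++ s ≪ b ++ t.
Proof.
elim: a b => [|x a IH] [|y b] //= [h|[-> h]]; first by left.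
by right; split=> //; apply: IH.
Qed.

Lemma slt_catr a b t : a ≪ b -> a ≪ b ++ t.
Proof. by move=> h; rewrite -[a]cats0; apply: slt_cat. Qed.

Lemma slt_catl p a b : p ++ a ≪ p ++ b <-> a ≪ b.
Proof.
elim: p => //= x p ->; split=> [[/ltxx|[]]|] //; by right.
Qed.

Lemma slt_irr a : ~ a ≪ a.
Proof. by elim: a => //= x a IH [/ltxx|[]]. Qed.

Lemma slt_trans b a c : a ≪ b -> b ≪ c -> a ≪ c.
Proof.
elim: b a c => [|y b IH] [|x a] [|z c] //= [h|[-> h]] [k|[<- k]].
- by left; apply: lttr k h.
- by left.
- by left.
- by right; split=> //; apply: IH.
Qed.

Lemma slt_llt a b : a ≪ b -> a ≺ b.
Proof.
elim: a b => [|x a IH] [|y b] //= [h|[-> h]]; first by left.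
by right; split=> //; apply: IH.
Qed.

Lemma llt_irr a : ~ a ≺ a.
Proof. by elim: a => //= x a IH [/ltxx|[]]. Qed.

Lemma llt_trans b a c : a ≺ b -> b ≺ c -> a ≺ c.
Proof.
elim: b a c => [|y b IH] [|x a] [|z c] //= [h|[-> h]] [k|[<- k]].
- by left; apply: lttr k h.
- by left.
- by left.
- by right; split=> //; apply: IH.
Qed.

Lemma llt_total a b : a = b \/ a ≺ b \/ b ≺ a.
Proof.
elim: a b => [|x a IH] [|y b] /=;
  [by left | by right; left | by right; right |].
have [->|[h|h]] := lttot x y; last 2 first.
- by right; right; left.
- by right; left; left.
have [->|[h|h]] := IH b; first by left.
- by right; left; right.
- by right; right; right.
Qed.

Lemma llt_cat a t : t <> [::] -> a ≺ a ++ t.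
Proof. by move=> t0; elim: a => [|x a IH] /=; [case: t t0 | right]. Qed.

Lemma lltP a b : a ≺ b -> a ≪ b \/ exists2 t, t <> [::] & b = a ++ t.
Proof.
elim: a b => [|x a IH] [|y b] //=; first by move=> _; right; exists (y :: b).
case=> [h|[-> /IH[h|[t t0 ->]]]]; first by left; left.
- by left; right.
- by right; exists t.
Qed.

Lemma llt_size a b : (size b <= size a)%N -> a ≺ b -> a ≪ b.
Proof.
move=> sz /lltP[//|[t t0 e]]; move: sz.
by rewrite e size_cat; case: t t0 {e} => //= x t _;
  rewrite addnS leqNgt ltnS leq_addr.
Qed.

Lemma lexlt_slt a b : size a = size b -> lexlt lt b a <-> a ≪ b.
Proof.
elim: a b => [|x a IH] [|y b] //=; first by move=> _; split=> // h; inversion h.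
move=> [sz]; split.
- by move=> h; inversion h; subst; [left | right; split=> //; apply/IH].
- by case=> [h|[-> /(IH _ sz)]]; constructor.
Qed.

Definition lyndon (lt : S -> S -> Prop) w : Prop :=
  w <> [::] /\ forall u v, u <> [::] -> v <> [::] -> w = u ++ v -> slt lt w v.
Local Notation lyn := (lyndon lt).

Lemma cat_eqsize a b s t : size a = size b -> a ++ s = b ++ t -> a = b /\ s = t.
Proof.
by elim: a b => [|x a IH] [|y b] //= [/IH h] [-> /h[-> ->]].
Qed.

Lemma cat_eq_le a b s t : a ++ s = b ++ t -> (size a <= size b)%N ->
  exists r, b = a ++ r /\ s = r ++ t.
Proof.
elim: a b => [|x a IH] b /=; first by move=> -> _; exists b.
case: b => [|y b] //=.
by move=> [<- /IH h]; rewrite ltnS => /h[r [-> ->]]; exists r.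
Qed.

(** Let [w = uv] be greater than its rotations. Comparing with [vu], either a
    letter separates [v] from [w], or [w = vy]. In the second case the rotations
    [vu] and [yv] order [u] and [y] in opposite ways. *)
Lemma regularE w : regular lt w <-> lyn w.
Proof.
split=> -[w0 h]; split=> // u v u0 v0 e; last first.
  apply/lexlt_slt; first by rewrite e !size_cat addnC.
  exact/slt_catr/(h u v).
have /lexlt_slt : lexlt lt (v ++ u) w by apply: h.
rewrite e !size_cat addnC => /(_ erefl).
have [x [y [exy sx]]] : exists x y, u ++ v = x ++ y /\ size x = size v.
  exists (take (size v) (u ++ v)), (drop (size v) (u ++ v)).
  by rewrite cat_take_drop size_takel // size_cat leq_addl.
rewrite exy => k; have [l|exv] : x ≪ v \/ x = v.
  elim: x v sx {exy e h v0} k => [|a x IH] [|b v] //=; first by right.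
  move=> [sz] [l|[-> /(IH _ sz)[l|->]]];
    [by left; left | by left; right | by right].
- by rewrite -[v]cats0; apply: slt_cat.
subst x; move: k => /slt_catl k.
have sz : size u = size y.
  by move/(congr1 size): exy; rewrite !size_cat addnC => /addnI.
have y0 : y <> [::] by move=> y0; apply: u0; apply: size0nil; rewrite sz y0.
have: lexlt lt (y ++ v) w by apply: h => //; rewrite e.
move/lexlt_slt; rewrite e !size_cat sz addnC => /(_ erefl) k'.
exfalso; apply: (@slt_irr (y ++ v)).
by apply: slt_trans k'; apply: slt_cat.
Qed.

Definition csplit (lt : S -> S -> Prop) u v :=
  [/\ u <> [::], lyndon lt v
    & forall u' v', u' <> [::] -> lyndon lt v' -> u ++ v = u' ++ v' ->
        (size v' <= size v)%N].

Lemma canonical_splitE u v : canonical_split lt u v <-> csplit lt u v.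
Proof.
split=> -[u0 /regularE v0 h]; split=> // u' v' u'0 /regularE; exact: h.
Qed.

Lemma catl_ne u v : u <> [::] -> u ++ v <> [::]. Proof. by case: u. Qed.
Lemma catr_ne u v : v <> [::] -> u ++ v <> [::]. Proof. by case: u. Qed.

Lemma lyndon_suffix u v : lyn (u ++ v) -> u <> [::] -> v <> [::] -> u ++ v ≪ v.
Proof. by move=> [_ h] u0 v0; apply: (h u v). Qed.

(** When no letter separates [u] from [v], that is [v = ut], comparing [uv] with
    [v] amounts to comparing [v] with its proper suffix [t]. *)
Lemma slt_cat_lyndon u v : lyn v -> u ≺ v -> u <> [::] -> u ++ v ≪ v.
Proof.
move=> lv /lltP[h|[t t0 e]] u0; first by rewrite -[X in _ ≪ X]cats0;
  apply: slt_cat.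
rewrite {2}e; apply/slt_catl.
by apply: (proj2 lv u t).
Qed.

Lemma lyndon_cat u v : lyn u -> lyn v -> u ≺ v -> lyn (u ++ v).
Proof.
move=> lu lv uv; have u0 := proj1 lu; have v0 := proj1 lv.
have uvv := slt_cat_lyndon lv uv u0.
split; first exact: catl_ne.
move=> p s p0 s0 e.
case: (leqP (size u) (size p)) => sz.
- have [r [ep es]] := cat_eq_le e sz.
  case: r ep es => [|x r] ep es; first by rewrite -[s]/([::] ++ s) -es.
  by apply: slt_trans uvv _; apply: (proj2 lv (x :: r) s).
- have [r [ep es]] := cat_eq_le (esym e) (ltnW sz); rewrite es.
  apply: slt_cat; apply: (proj2 lu p r) => // r0.
  by move: sz; rewrite ep r0 cats0 ltnn.
Qed.

(** The least nonempty suffix is Lyndon because its own suffixes are among its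
    competitors. *)
Lemma min_suffix w : w <> [::] ->
  exists p m, [/\ w = p ++ m, lyn m &
     forall q s, s <> [::] -> w = q ++ s -> m = s \/ m ≺ s].
Proof.
elim: w => // x w IH _.
case: (pselect (w = [::])) => [->|w0].
  exists [::], [:: x]; split=> //.
  - by split=> // -[|a [|b u]] [|c v].
  - by move=> [|a [|b u]] [|c v] //= _ [-> ->]; left.
have [p [m [e lm h]]] := IH w0.
have lyn_of : (forall q s, q <> [::] -> s <> [::] -> x :: w = q ++ s ->
  x :: w ≺ s) -> lyn (x :: w).
  move=> k; split=> // q s q0 s0 es.
  apply: llt_size; last exact: k es.
  by rewrite es size_cat leq_addl.
have [em|[l|l]] := llt_total m (x :: w).
- move: (congr1 size em); rewrite e /= size_cat => /eqP.
  by rewrite eqn_leq andbC ltnNge leq_addl.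
- exists (x :: p), m; split=> //; first by rewrite e.
  move=> [|y q] s s0 /= => [<-|[_ ews]]; [by right | exact: h ews].
- exists [::], (x :: w); split=> //.
  + apply: lyn_of => -[|y q] s q0 s0 //= [_ ews].
    have [<-//|k] := h _ _ s0 ews; exact: llt_trans l k.
  + move=> [|y q] s s0 /= => [<-|[_ ews]]; first by left.
    right; have [<-//|k] := h _ _ s0 ews; exact: llt_trans l k.
Qed.

(** The least suffix is Lyndon, hence no longer than [v], hence a suffix of [v];
    as [v] is below its proper suffixes, the two coincide. *)
Lemma csplit_min u v : csplit lt u v ->
  forall q s, q <> [::] -> s <> [::] -> u ++ v = q ++ s -> v = s \/ v ≺ s.
Proof.
move=> [u0 lv h] q s q0 s0 e.
case: u u0 h e => // x u _ h e.
have [p [m [em lm hm]]] := @min_suffix (u ++ v) (catr_ne (proj1 lv)).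
have es : exists q', u ++ v = q' ++ s.
  by case: q q0 e => // y q _ [_ ->]; exists q.
have sz : (size m <= size v)%N by apply: (h (x :: p)) => //=; rewrite em.
have vm : v = m.
  have : (size u <= size p)%N.
    move/(congr1 size): em; rewrite !size_cat => es'.
    by rewrite -(leq_add2r (size v)) es' leq_add2l.
  move=> /(cat_eq_le em)[[|y r] [ep ev]]; first by [].
  have hv : v = m \/ m ≺ v by have [] := hm u v (proj1 lv) erefl; [left|right].
  case: hv => // hv; exfalso; apply: (@llt_irr m); apply: llt_trans hv _.
  by apply: slt_llt; apply: (proj2 lv (y :: r) m) => //; case: lm.
by case: es => q' es; rewrite vm; apply: hm es.
Qed.

Lemma csplit_letter x v : lyn v -> csplit lt [:: x] v.
Proof.
move=> lv; split=> // -[|y u'] v' // _ _ /(congr1 size) /=.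
by rewrite size_cat => -[->]; rewrite leq_addl.
Qed.

(** A longer Lyndon suffix would be [sv] with [s] a proper suffix of [u1 u2].
    Then [s] is below [sv], hence below [v], while [u2] is at most [s]. *)
Lemma csplit_cat u1 u2 v : csplit lt u1 u2 -> lyn v -> ~ u2 ≺ v ->
  csplit lt (u1 ++ u2) v.
Proof.
move=> cs lv nlt; have [u10 lu2 _] := cs; split=> //; first exact: catl_ne.
move=> u' v' u'0 lv' e; rewrite leqNgt; apply/negP => sz.
have : (size u' <= size (u1 ++ u2))%N.
  move/(congr1 size): e; rewrite size_cat [RHS]size_cat => es.
  by rewrite -(leq_add2r (size v)) es leq_add2l ltnW.
move/(cat_eq_le (esym e)) => [s [eu ev']].
have s0 : s <> [::] by move=> s0; move: sz; rewrite ev' s0 ltnn.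
have sv : s ≺ v.
  apply: (@llt_trans (s ++ v)); first by apply: llt_cat; case: lv.
  by rewrite -ev'; apply: slt_llt; apply: (proj2 lv' s v) => //; case: lv.
by have [e2|l] := csplit_min cs u'0 s0 eu; apply: nlt;
  [rewrite e2 | apply: llt_trans sv].
Qed.

(** Otherwise [u2 v] would be a longer Lyndon suffix. *)
Lemma csplit_nlt u1 u2 v : csplit lt (u1 ++ u2) v -> u1 <> [::] -> lyn u2 ->
  ~ u2 ≺ v.
Proof.
move=> [_ lv h] u10 lu2 l.
have := h u1 (u2 ++ v) u10 (lyndon_cat lu2 lv l); rewrite -catA => /(_ erefl).
by case: lu2 => + _; case: (u2) => // x r _;
  rewrite /= size_cat ltnNge leq_addl.
Qed.

(** Let [s] be the least suffix of [u]. If [s] is not [u], it is below [u], and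
    then a prefix of it, since a separating letter would put the suffix [sv] of
    [uv] below [uv].
    Maximality of [v] gives that [v] is at most [s], a prefix of [uv], against
    [uv] being strictly below [v]. *)
Lemma csplit_lyndonl u v : lyn (u ++ v) -> csplit lt u v -> lyn u.
Proof.
move=> lw cs; have [u0 lv h] := cs.
have wv := lyndon_suffix lw u0 (proj1 lv).
have [p [s [eu ls hs]]] := @min_suffix u u0.
case: p eu => [-> //|x p] eu.
have s0 := proj1 ls.
have us : ~ u ≪ s.
  move=> k; have [e|l] := hs [::] u u0 erefl.
    by apply: (@slt_irr u); rewrite e in k.
  exact: (@llt_irr _ (llt_trans l (slt_llt k))).
have nsv : ~ s ≺ v by apply: (@csplit_nlt (x :: p)) => //; rewrite -eu.
have [e|/lltP[l|[t t0 e]]] := hs [::] u u0 erefl.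
- move/(congr1 size)/eqP: eu; rewrite e size_cat /= eqn_leq andbC.
  by rewrite addSn ltnNge leq_addl.
- exfalso; apply: (@slt_irr (u ++ v)).
  apply: (@slt_trans (s ++ v)); last exact: slt_cat.
  by apply: (proj2 lw (x :: p)) => //; [apply: catl_ne | rewrite {1}eu -catA].
exfalso; move: wv; rewrite e -catA => wv.
have [ev|[//|/lltP[l|[r r0 ev]]]] := llt_total s v.
- by move: wv; rewrite -ev -[X in _ ≪ X]cats0 => /slt_catl; case: (t ++ s).
- by apply: (@slt_irr v); apply: slt_trans wv; apply: slt_catr.
- move: wv; rewrite ev -catA -[X in _ ≪ X]cats0 => /slt_catl.
  by case: (_ ++ _).
Qed.

Lemma lyndon_letter x : lyn [:: x].
Proof. by split=> // -[|a [|b u]] [|c v]. Qed.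

Lemma lyndon_split w : lyn w -> (exists x, w = [:: x]) \/
  exists u v, [/\ w = u ++ v, lyn u, lyn v & csplit lt u v].
Proof.
case: w => [[]//|x w] lw.
case: (pselect (w = [::])) => [->|w0]; first by left; exists x.
right; have [p [m [e lm h]]] := @min_suffix w w0.
have cs : csplit lt (x :: p) m.
  split=> // -[|y u'] v' // _ lv' [_] e'; rewrite leqNgt; apply/negP => sz.
  have : (size u' <= size p)%N.
    move/(congr1 size): e'; rewrite !size_cat => es.
    by rewrite -(leq_add2r (size m)) es leq_add2l ltnW.
  move/(cat_eq_le (esym e')) => [[|z r] [ep ev]]; first by move: sz;
    rewrite ev ltnn.
  have [k|k] := h u' v' (proj1 lv') (etrans e e').
    by move: sz; rewrite k ltnn.
  exfalso; apply: (@llt_irr m); apply: llt_trans k _.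
  by apply: slt_llt; apply: (proj2 lv' (z :: r) m) => //; case: lm.
exists (x :: p), m; split=> //; first by rewrite e.
by apply: csplit_lyndonl cs; rewrite /= -e.
Qed.

Lemma csplit_uniq u v u' v' : csplit lt u v -> csplit lt u' v' ->
  u ++ v = u' ++ v' ->
  u = u' /\ v = v'.
Proof.
move=> [u0 lv h] [u'0 lv' h'] e.
have sz : size v = size v'.
  by apply/eqP; rewrite eqn_leq; apply/andP; split;
    [apply: h' (esym e) | apply: h e].
apply: (cat_eqsize _ e); move/(congr1 size): e.
by rewrite !size_cat sz => /addIn.
Qed.

Lemma csplit_lt u v : lyn (u ++ v) -> csplit lt u v -> u ≺ v.
Proof.
move=> lw [u0 [v0 _] _]; apply: (@llt_trans (u ++ v)); first exact: llt_cat.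
exact/slt_llt/lyndon_suffix.
Qed.

End WordOrder.

(** * Linear combinations and brackets *)
Section Span.
Variables (F : fieldType) (V : lmodType F).
Implicit Types X Y : set V.

Lemma subspaceD X u v : subspace X -> X u -> X v -> X (u + v).
Proof. by move=> [_ h] hu hv; rewrite -[u]scale1r; apply: h. Qed.

Lemma subspaceZ X a u : subspace X -> X u -> X (a *: u).
Proof. by move=> [h0 h] hu; rewrite -[_ *: _]addr0; apply: h. Qed.

Lemma subspaceN X u : subspace X -> X u -> X (- u).
Proof. by move=> hX hu; rewrite -scaleN1r; apply: subspaceZ. Qed.

Lemma subspace_sum X n (f : 'I_n -> V) : subspace X -> (forall i, X (f i)) ->
  X (\sum_i f i).
Proof.
move=> hX hf; elim/big_ind: _ => // [|u v hu hv]; first by case: hX.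
exact: subspaceD.
Qed.

Lemma span_subspace X : subspace (span X).
Proof.
split; first by exists 0%N, (fun=> 0), (fun=> 0); split;
  [case | rewrite big_ord0].
move=> a u v [n [l [x [hx ->]]]] [m [k [y [hy ->]]]].
exists (n + m)%N, (fun i => match split i with inl i => a * l i | inr i =>
  k i end),
  (fun i => match split i with inl i => x i | inr i => y i end); split.
  by move=> i; case: split.
rewrite big_split_ord /= scaler_sumr; congr (_ + _); apply: eq_bigr => i _.
  by rewrite -/(unsplit (inl i)) unsplitK scalerA.
by rewrite -/(unsplit (inr i)) unsplitK.
Qed.

Lemma sub_span X : X `<=` span X.
Proof.
move=> x Xx; exists 1%N, (fun=> 1), (fun=> x); split=> //.
by rewrite big_ord1 scale1r.
Qed.

Lemma span_min X Y : subspace Y -> X `<=` Y -> span X `<=` Y.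
Proof.
move=> hY XY _ [n [a [x [hx ->]]]]; apply: subspace_sum => // i.
by apply: subspaceZ => //; apply: XY.
Qed.

Lemma span_mono X Y : X `<=` Y -> span X `<=` span Y.
Proof.
move=> XY; apply: span_min; first exact: span_subspace.
by move=> x /XY; apply: sub_span.
Qed.

Lemma span0 X : span X 0. Proof. by case: (span_subspace X). Qed.

End Span.

Lemma span_ind (F : fieldType) (V : lmodType F) (X : set V) (P : V -> Prop) :
  subspace (P : set V) -> (forall x, X x -> P x) -> forall v, span X v -> P v.
Proof. by move=> hP XP v; apply: (span_min hP). Qed.

Section Lie.
Variables (F : fieldType) (L : lieAlgType F).
Implicit Types x y z : L.

Lemma lbr0l z : lbr 0 z = 0 :> L.
Proof.
have := lbr_linearl 1 0 0 z; rewrite !scale1r addr0 -{1}[lbr 0 z]addr0.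
by move=> /addrI.
Qed.
Lemma lbrDl x y z : lbr (x + y) z = lbr x z + lbr y z.
Proof. by have := lbr_linearl 1 x y z; rewrite !scale1r. Qed.
Lemma lbrDr x y z : lbr z (x + y) = lbr z x + lbr z y.
Proof. by have := lbr_linearr 1 x y z; rewrite !scale1r. Qed.

Lemma lbrC x y : lbr x y = - lbr y x.
Proof.
have := lbrxx (x + y); rewrite lbrDl !lbrDr !lbrxx add0r addr0.
by move/eqP; rewrite addr_eq0 => /eqP.
Qed.
Lemma lbr0r z : lbr z 0 = 0 :> L.
Proof. by rewrite lbrC lbr0l oppr0. Qed.

Lemma subspace_lbrl (Z : set L) z : subspace Z ->
  subspace [set x | Z (lbr x z)].
Proof.
move=> [h0 hZ]; split; first by rewrite /= lbr0l.
by move=> a u v hu hv; rewrite /= lbr_linearl; apply: hZ.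
Qed.

Lemma subspace_lbrr (Z : set L) z : subspace Z ->
  subspace [set x | Z (lbr z x)].
Proof.
move=> [h0 hZ]; split; first by rewrite /= lbr0r.
by move=> a u v hu hv; rewrite /= lbr_linearr; apply: hZ.
Qed.

Lemma span_lbr (X Y Z : set L) : subspace Z ->
  (forall x y, X x -> Y y -> Z (lbr x y)) ->
  forall x y, span X x -> span Y y -> Z (lbr x y).
Proof.
move=> hZ h x y hx hy; elim/span_ind: hy x hx => [|{}y Yy].
  split=> [x _|a u v hu hv x hx]; first by rewrite lbr0r; case: hZ.
  by rewrite lbr_linearr; case: hZ => _; apply; [apply: hu | apply: hv].
by apply: span_min; [apply: subspace_lbrl | move=> x Xx; apply: h].
Qed.

Lemma lbrNr x y : lbr x (- y) = - lbr x y.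
Proof. by apply/eqP; rewrite -addr_eq0 -lbrDr addNr lbr0r. Qed.

Lemma lbr_derl x y z : lbr x (lbr y z) = lbr (lbr x y) z + lbr y (lbr x z).
Proof.
have /eqP := lbr_jacobi x y z.
rewrite (lbrC z x) lbrNr -addrA addr_eq0 => /eqP ->.
by rewrite opprD opprK addrC -lbrC.
Qed.

Lemma lbr_derr x y z : lbr (lbr x y) z = lbr (lbr x z) y + lbr x (lbr y z).
Proof. by rewrite [lbr x (lbr y z)]lbr_derl addrCA (lbrC (lbr x z)) addNr
  addr0. Qed.

End Lie.

(** On a finite set of values every strict order is well founded. *)
Lemma finite_ind (T : eqType) (K : seq T) (R : T -> T -> Prop) (P : T -> Prop) :
  (forall x, ~ R x x) -> (forall y x z, R x y -> R y z -> R x z) ->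
  (forall v, v \in K -> (forall v', v' \in K -> R v' v -> P v') -> P v) ->
  forall v, v \in K -> P v.
Proof.
move=> irr tr IH v; have [n] := ubnP (count (fun t => `[< R t v >]) K).
elim: n v => // n IHn v; rewrite ltnS => le_n vK.
apply: IH => // v' v'K rv; apply: IHn => //; apply: leq_trans le_n.
have -> : count (fun t => `[< R t v >]) K =
  (count (fun t => `[< R t v' >]) K +
    count (fun t => `[< R t v >] && ~~ `[< R t v' >]) K)%N.
  rewrite -count_predUI [X in (_ + X)%N](_ : _ = 0%N) ?addn0; last first.
    by rewrite -[RHS](count_pred0 K); apply: eq_count => t /=;
      case: `[< R t v' >]; rewrite ?andbF.
  apply: eq_count => t /=; case: (asboolP (R t v')) => [h|_] /=;
    last by rewrite andbT.
  by apply/asboolP; apply: tr h rv.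
rewrite -addn1 leq_add2l -has_count; apply/hasP; exists v' => //=.
by apply/andP; split; [apply/asboolP | apply/asboolPn; apply: irr].
Qed.

(** * Canonical bracketings as a function *)
Section Bracketing.
Variables (F : fieldType) (S : Type) (lt : S -> S -> Prop).
Hypothesis ltO : strict_total_order lt.

Section Image.
Variables (L M : lieAlgType F) (h : L -> M) (gen : S -> L).
Hypothesis hm : lie_morph h.

Lemma bracketing_morph w x : bracketing lt gen w x ->
  bracketing lt (h \o gen) w (h x).
Proof.
elim=> [s|u v a b cs _ ha _ hb]; first exact: (BrLetter lt (h \o gen)).
by rewrite hm; apply: BrSplit.
Qed.

Lemma bracketing_morph_inv w y : bracketing lt (h \o gen) w y ->
  exists2 x, bracketing lt gen w x & y = h x.
Proof.
elim=> [s|u v a b cs _ [x bx ->] _ [x' bx' ->]]; first by exists (gen s) => //;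
  apply: BrLetter.
by exists (lbr x x'); [apply: BrSplit | rewrite hm].
Qed.
End Image.

Variables (M : lieAlgType F) (gen : S -> M).

Lemma bracketing_inv w x : bracketing lt gen w x ->
  (exists2 s, w = [:: s] & x = gen s) \/
  exists u v a b, [/\ w = u ++ v, x = lbr a b, csplit lt u v &
     bracketing lt gen u a /\ bracketing lt gen v b].
Proof.
case=> [s|u v a b /(canonical_splitE ltO) cs ha hb]; first by left; exists s.
by right; exists u, v, a, b.
Qed.

Lemma csplit_not_letter u v s : csplit lt u v -> u ++ v = [:: s] -> False.
Proof. by case; case: u => [//|a [|b u]] _ [v0 _] _; case: v v0. Qed.

Lemma bracketing_uniq w x y :
  bracketing lt gen w x -> bracketing lt gen w y -> x = y.
Proof.
move=> bx; elim: bx y => [s|u v a b /(canonical_splitE ltO) cs _ IHu _ IHv] y.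
  case/bracketing_inv=> [[t [->]]//|[u [v [a [b [e _ cs _]]]]]].
  by case: (csplit_not_letter cs (esym e)).
case/bracketing_inv=> [[t e]|[u' [v' [a' [b' [e -> cs' [ha hb]]]]]]].
  by case: (csplit_not_letter cs e).
have [eu ev] := csplit_uniq cs cs' e; subst u' v'.
by rewrite (IHu _ ha) (IHv _ hb).
Qed.

(** [bracketing] is a functional relation whose domain contains the regular
    words; making it a function lets spans be indexed by words. *)
Definition br w : M := xget 0 [set x | bracketing lt gen w x].

Lemma brP w x : bracketing lt gen w x -> br w = x.
Proof.
move=> hx; apply: (bracketing_uniq _ hx).
exact: (xgetI 0 hx).
Qed.

Lemma lyndon_bracketing w : lyndon lt w -> bracketing lt gen w (br w).
Proof.
move=> lw; suff [x hx] : exists x, bracketing lt gen w x by rewrite (brP hx).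
have [n] := ubnP (size w); elim: n w lw => // n IH w lw sz.
have [[s ->]|[u [v [e lu lv cs]]]] := lyndon_split ltO lw.
  by exists (gen s); apply: BrLetter.
have u0 : (0 < size u)%N by case: lu; case: (u).
have v0 : (0 < size v)%N by case: lv; case: (v).
move: sz; rewrite e size_cat ltnS => sz.
have [a ha] : exists x, bracketing lt gen u x.
  by apply: IH => //; apply: leq_trans sz; rewrite -addn1 leq_add2l.
have [b hb] : exists x, bracketing lt gen v x.
  by apply: IH => //; apply: leq_trans sz; rewrite -add1n leq_add2r.
by exists (lbr a b); apply: BrSplit => //; apply/canonical_splitE.
Qed.

Lemma br_letter s : br [:: s] = gen s.
Proof. exact/brP/BrLetter. Qed.

Lemma br_split u v : lyndon lt u -> csplit lt u v ->
  br (u ++ v) = lbr (br u) (br v).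
Proof.
move=> lu cs; apply: brP; apply: BrSplit; first exact/canonical_splitE.
  exact: lyndon_bracketing.
by apply: lyndon_bracketing; case: cs.
Qed.

End Bracketing.

(** * Rewriting to reduced words *)
Section Factors.
Variables (S : Type) (redex : S -> S -> Prop).
Implicit Types u v w : seq S.

Fixpoint has_adjacent w : Prop :=
  match w with
  | x :: w' => (match w' with y :: _ => redex x y | [::] => False end) \/
    has_adjacent w'
  | [::] => False
  end.

Lemma has_adjacent_cat u v : has_adjacent (u ++ v) ->
  [\/ has_adjacent u, has_adjacent v
    | exists u' x y v', [/\ u = rcons u' x, v = y :: v' & redex x y]].
Proof.
elim: u => [|x u IH] /=; first by constructor 2.
case; last first.
  case/IH => [h|h|[u' [a [b [v' [-> ev h]]]]]].
  - by constructor 1; right.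
  - by constructor 2.
  - by constructor 3; exists (x :: u'), a, b, v'.
case: u {IH} => [|a u] /=; last by move=> h; constructor 1; left.
by case: v => [|y v] //= h; constructor 3; exists [::], x, y, v.
Qed.

Lemma has_adjacentP w : has_adjacent w <-> exists u x y v,
  w = u ++ [:: x; y] ++ v /\ redex x y.
Proof.
split.
  elim: w => //= x w IH [|/IH[u [a [b [v [-> h]]]]]].
    by case: w {IH} => // y w h; exists [::], x, y, w.
  by exists (x :: u), a, b, v.
case=> u [x [y [v [-> h]]]].
by elim: u => /= [|a u IH]; [left | right].
Qed.

End Factors.

Section Spanning.
Variables (F : fieldType) (M : lieAlgType F) (S : eqType) (lt : S -> S -> Prop).
Hypothesis ltO : strict_total_order lt.
Variable gen : S -> M.
Local Notation "a ≪ b" := (slt lt a b) (at level 70).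
Local Notation "a ≺ b" := (llt lt a b) (at level 70).
Local Notation lyn := (lyndon lt).
Local Notation br := (br lt gen).
Implicit Types (u v w z : seq S).

Definition brspan (W : set (seq S)) : set M := span (br @` W).

Lemma brspan_sub (W : set (seq S)) : subspace (brspan W).
Proof. exact: span_subspace. Qed.

Lemma brspan_in (W : set (seq S)) w : W w -> brspan W (br w).
Proof. by move=> h; apply: sub_span; exists w. Qed.

Lemma brspan_ind (W : set (seq S)) (P : set M) : subspace P ->
  (forall w, W w -> P (br w)) -> brspan W `<=` P.
Proof. by move=> hP h; apply: span_min => // _ [w Ww <-]; apply: h. Qed.

Lemma brspan_mono (W W' : set (seq S)) : W `<=` W' -> brspan W `<=` brspan W'.
Proof. by move=> h; apply: span_mono => _ [w /h Ww <-]; exists w. Qed.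

Lemma slt_eq_cat a b w t : b ≪ a ++ t -> w = a \/ a ≪ w -> b ≪ w ++ t.
Proof. by move=> h [->//|k]; apply: (slt_trans ltO h); apply: slt_cat. Qed.

Lemma brspan_diff (W : set (seq S)) x w : brspan W (x - br w) ->
  brspan [set t | t = w \/ W t] x.
Proof.
move=> h; rewrite -(subrK (br w) x); apply: subspaceD; first exact: brspan_sub.
  by apply: brspan_mono h => t; right.
by apply: brspan_in; left.
Qed.

(** A finite set containing every [v] for which some [uv] rearranges [z], as [v]
    is a prefix of [vu]. *)
Definition prefixes_of_perms z : seq (seq S) :=
  [seq take k s | s <- permutations z, k <- iota 0 (size z).+1].

Lemma in_prefixes u v z : perm_eq (u ++ v) z -> v \in prefixes_of_perms z.
Proof.
move=> p; apply/allpairsP; exists (v ++ u, size v); split.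
- by rewrite mem_permutations /= perm_catC.
- by rewrite mem_iota /= add0n ltnS -(perm_size p) size_cat leq_addl.
- by rewrite /= take_size_cat.
Qed.

(** Either [[[u],[v]]] is already a canonical bracketing, or the right factor of
    [u] has to be moved across [v]. *)
Lemma csplit_or_descend u v : lyn u -> lyn v -> u ≺ v ->
  csplit lt u v \/
  exists u1 u2, [/\ u = u1 ++ u2, lyn u1, lyn u2, csplit lt u1 u2 & u2 ≺ v].
Proof.
move=> lu lv uv; have [[x ->]|[u1 [u2 [e l1 l2 cs]]]] := lyndon_split ltO lu.
  by left; apply: csplit_letter.
case: (pselect (u2 ≺ v)) => h; first by right; exists u1, u2.
by left; rewrite e; apply: csplit_cat.
Qed.

Definition above u v : set (seq S) :=
  [set w | [/\ lyn w, perm_eq w (u ++ v), u ++ v ≪ w & w ≺ v]].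

(** If [(u, v)] is not the standard factorization of [uv], write [u = u1 u2]
    standardly, with [u2] below [v], and expand
    [[[u1,u2],v] = [[u1,v],u2] + [u1,[u2,v]]]. The inner brackets are shorter.
    The outer ones have the same length, but their larger factor is below [v]:
    this is why the bound [w ≺ v] is part of the claim, and why the induction is
    on the length first and on [v] next. The only term that does not rise above
    [uv] is [[u1 u2 v]], from the leading term of [[u2,v]]. *)
Lemma br_product u v : lyn u -> lyn v -> u ≺ v ->
  brspan (above u v) (lbr (br u) (br v) - br (u ++ v)).
Proof.
have [n] := ubnP (size (u ++ v)); elim: n u v => // n IHn u v;
  rewrite ltnS => + lu lv uv.
move=> le_n; suff main z : (size z <= n)%N ->
  forall v, v \in prefixes_of_perms z ->
    forall u, lyn u -> lyn v -> u ≺ v -> perm_eq (u ++ v) z ->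
    brspan (above u v) (lbr (br u) (br v) - br (u ++ v)).
  exact: main le_n _ (in_prefixes (perm_refl _)) _ lu lv uv (perm_refl _).
move=> {u v lu lv uv le_n} sz.
apply: (finite_ind (R := llt lt)); [exact: llt_irr | exact: llt_trans |].
move=> v vK IH u lu lv uv pz.
case: (csplit_or_descend lu lv uv) => [cs|].
  by rewrite -br_split // subrr; apply: span0.
case=> u1 [u2 [e l1 l2 cs u2v]].
have lt12 : u1 ≺ u2 by apply: csplit_lt => //; rewrite -e.
have u10 : u1 <> [::] by case: l1.
have u20 : u2 <> [::] by case: l2.
have v0 : v <> [::] by case: lv.
have uu2 : u ≪ u2 by rewrite e; apply: lyndon_suffix; rewrite -?e.
have su1 : (0 < size u1)%N by case: (u1) u10.
have su2 : (0 < size u2)%N by case: (u2) u20.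
have u1v : u1 ≺ v by apply: (llt_trans ltO lt12).
have lu1v := lyndon_cat ltO l1 lv u1v.
have lu2v := lyndon_cat ltO l2 lv u2v.
have u2vv : u2 ++ v ≪ v by apply: lyndon_suffix.
have size_uv : size (u1 ++ u2 ++ v) = size z by rewrite catA -e (perm_size pz).
have sz1 : (size (u1 ++ v) < n)%N.
  apply: leq_trans sz; rewrite -size_uv !size_cat ltn_add2l.
  by rewrite -[X in (X < _)%N]add0n ltn_add2r.
have sz2 : (size (u2 ++ v) < n)%N.
  by apply: leq_trans sz; rewrite -size_uv (size_cat u1) -add1n leq_add2r.
have uE : u ++ v = u1 ++ u2 ++ v by rewrite e catA.
pose Z := brspan (above u v).
have ZS : subspace Z by apply: brspan_sub.
(* The induction on v, for two factors of a rearrangement of uv. *)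
have weak p q : lyn p -> lyn q -> p ≺ q -> q ≺ v -> perm_eq (p ++ q) (u ++ v) ->
    u ++ v ≪ p ++ q -> Z (lbr (br p) (br q)).
  move=> lp lq pq qv pp hpq.
  have pp' := perm_trans pp pz.
  have h := IH q (in_prefixes pp') qv p lp lq pq pp'.
  have {h} := brspan_diff h; apply: brspan_mono => w [->|[lw pw hw wq]];
    split=> //.
  - exact: lyndon_cat.
  - by apply: llt_trans qv => //; apply/slt_llt/lyndon_suffix => //;
      [apply: lyndon_cat | case: lp | case: lq].
  - exact: perm_trans pw pp.
  - exact: slt_trans hw.
  - exact: llt_trans wq qv.
have -> : lbr (br u) (br v) - br (u ++ v) =
  lbr (lbr (br u1) (br v)) (br u2) +
    (lbr (br u1) (lbr (br u2) (br v)) - br (u1 ++ u2 ++ v)).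
  by rewrite uE e (br_split ltO gen l1 cs) lbr_derr addrA.
apply: (@subspaceD _ _ Z) => //.
(* [[u1,v],u2]: every term is above uv, since u2 v is below v u2. *)
- have := brspan_diff (IHn u1 v sz1 l1 lv u1v).
  apply: (@brspan_ind _ [set x | Z (lbr x (br u2))]);
    first exact: subspace_lbrl.
  move=> w hw.
  have {hw} [lw pw hw wv] :
    [/\ lyn w, perm_eq w (u1 ++ v), (w = u1 ++ v) \/ u1 ++ v ≪ w & w ≺ v].
    case: hw => [->|[]]; last by split=> //; right.
    by split=> //; [left | apply/slt_llt/lyndon_suffix].
  have pw2 : perm_eq (w ++ u2) (u ++ v).
    apply: (@perm_trans _ ((u1 ++ v) ++ u2)); first by rewrite perm_cat2r.
    by rewrite uE -catA perm_cat2l perm_catC.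
  rewrite /=.
  have [->|[h|h]] := llt_total ltO w u2; first by rewrite lbrxx; apply: span0.
  + apply: weak => //; apply: slt_eq_cat hw.
    rewrite uE -catA; apply/slt_catl => //.
    by apply: slt_catr; apply: lyndon_suffix.
  + rewrite lbrC; apply: subspaceN => //; apply: weak => //;
      first by rewrite perm_catC.
    exact: slt_cat.
(* [u1,[u2,v]]: the leading term [u2 v] contributes [u1 u2 v]. *)
- pose D := lbr (br u2) (br v) - br (u2 ++ v).
  have u1u2v : u1 ≺ u2 ++ v.
    by apply: (llt_trans ltO lt12); apply: llt_cat.
  have -> : lbr (br u1) (lbr (br u2) (br v)) - br (u1 ++ u2 ++ v) =
    lbr (br u1) D + (lbr (br u1) (br (u2 ++ v)) - br (u1 ++ u2 ++ v)).
    by rewrite addrA -lbrDr subrK.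
  apply: subspaceD => //.
    have : brspan (above u2 v) D by apply: IHn.
    apply: (@brspan_ind _ [set x | Z (lbr (br u1) x)]);
      first exact: subspace_lbrr.
    move=> w [lw pw hw wv] /=; apply: weak => //.
    + by apply: (llt_trans ltO u1u2v); apply: slt_llt.
    + by rewrite uE perm_cat2l.
    + by rewrite uE; apply/slt_catl.
  have pp : perm_eq (u1 ++ u2 ++ v) z by rewrite -uE.
  have := IH (u2 ++ v) (in_prefixes pp) (slt_llt u2vv) u1 l1 lu2v u1u2v pp.
  apply: brspan_mono => w [lw pw hw wv]; split=> //; rewrite ?uE //.
  exact: (llt_trans ltO wv (slt_llt u2vv)).
Qed.

(** A redex is a descending pair of letters whose bracket rewrites to letters of
    at least the total weight. *)
Variables (wt : S -> nat) (redex : S -> S -> Prop).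
Definition wt_word w := (\sum_(s <- w) wt s)%N.
Local Notation has_adjacent := (has_adjacent redex).
Hypothesis redex_lt : forall x y, redex x y -> lt y x.
Hypothesis redex_lbr : forall x y, redex x y ->
  span (gen @` [set s | (wt x + wt y <= wt s)%N]) (lbr (gen x) (gen y)).

Lemma wt_word_cat u v : wt_word (u ++ v) = (wt_word u + wt_word v)%N.
Proof. by rewrite /wt_word big_cat. Qed.

Lemma wt_word_perm u v : perm_eq u v -> wt_word u = wt_word v.
Proof. exact: perm_big. Qed.

(** The words that may replace [z]. Passing from [z] to them cannot go on
    forever, because a word has finitely many rearrangements. *)
Definition dominated z : set (seq S) :=
  [set w | lyn w /\ (((size w < size z)%N /\ (wt_word z <= wt_word w)%N) \/
                     (perm_eq w z /\ z ≪ w))].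

Lemma lbr_dominated_lyn u v z : lyn u -> lyn v ->
  perm_eq (u ++ v) z -> z ≪ u ++ v -> z ≪ v ++ u ->
  brspan (dominated z) (lbr (br u) (br v)).
Proof.
move=> lu lv p h1 h2.
have main a b : lyn a -> lyn b -> a ≺ b -> perm_eq (a ++ b) z -> z ≪ a ++ b ->
    brspan (dominated z) (lbr (br a) (br b)).
  move=> la lb ab pz hz; have := brspan_diff (br_product la lb ab).
  apply: brspan_mono => w [->|[lw pw hw _]]; split=> //; try exact: lyndon_cat;
    right; split=> //.
    exact: perm_trans pw pz.
  exact: slt_trans hw.
have [->|[h|h]] := llt_total ltO u v; first by rewrite lbrxx; apply: span0.
  exact: main.
rewrite lbrC; apply: subspaceN; first exact: brspan_sub.
by apply: main => //; rewrite perm_catC.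
Qed.

Lemma lbr_dominated_size u v z : lyn u -> lyn v ->
  (size (u ++ v) < size z)%N -> (wt_word z <= wt_word (u ++ v))%N ->
  brspan (dominated z) (lbr (br u) (br v)).
Proof.
move=> lu lv h1 h2.
have main a b : lyn a -> lyn b -> a ≺ b -> (size (a ++ b) < size z)%N ->
  (wt_word z <= wt_word (a ++ b))%N ->
    brspan (dominated z) (lbr (br a) (br b)).
  move=> la lb ab sz wz; have := brspan_diff (br_product la lb ab).
  apply: brspan_mono => w [->|[lw pw hw _]]; split=> //; try exact: lyndon_cat;
    left; split=> //.
    by rewrite (perm_size pw).
  by rewrite (wt_word_perm pw).
have [->|[h|h]] := llt_total ltO u v; first by rewrite lbrxx; apply: span0.
  exact: main.
rewrite lbrC; apply: subspaceN; first exact: brspan_sub.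
apply: main => //; last by rewrite wt_word_cat addnC -wt_word_cat.
by rewrite size_cat addnC -size_cat.
Qed.

Lemma lyndon_rcons_slt u x : lyn (rcons u x) -> u <> [::] -> rcons u x ≪ [:: x].
Proof. by rewrite -cats1 => l u0; apply: lyndon_suffix. Qed.

(** Let [w = uv] be the standard factorization. A redex inside [u] or [v] is
    handled by induction, since bracketing respects domination. If the redex
    [xy] straddles, then [u] is the letter [x]: otherwise the right factor of
    [u], which ends in [x] and is at most [x], would be below [v], which begins
    with [y]. If [v = y], rewrite the redex. If [v = v1 v2] standardly, expand
    [[x,[v1,v2]] = [[x,v1],v2] + [v1,[x,v2]]]. The Lyndon word [x v1] contains
    the redex and is shorter than [w], so [[x,v1]] involves only words that
    [x v1] may be replaced by; in the last term, every word begins with a letter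
    above [x], or with a word that is at least [x v2]. *)
Lemma br_has_adjacent w : lyn w -> has_adjacent w ->
  brspan (dominated w) (br w).
Proof.
have [n] := ubnP (size w); elim: n w => // n IH w; rewrite ltnS => sz lw bw.
have ZS := brspan_sub (dominated w).
have [[x e]|[u [v [e lu lv cs]]]] := lyndon_split ltO lw.
  by move: bw; rewrite e /= => -[].
have u0 : u <> [::] by case: lu.
have v0 : v <> [::] by case: lv.
have su : (0 < size u)%N by case: (u) u0.
have sv : (0 < size v)%N by case: (v) v0.
have wv : w ≪ v by rewrite e; apply: lyndon_suffix; rewrite -?e.
have szu : (size u < n)%N.
  by apply: leq_trans sz; rewrite e size_cat -[X in (X < _)%N]addn0 ltn_add2l.
have szv : (size v < n)%N.
  by apply: leq_trans sz; rewrite e size_cat -[X in (X < _)%N]add0n ltn_add2r.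
have Ebr : br w = lbr (br u) (br v) by rewrite e br_split.
rewrite Ebr; move: bw; rewrite {1}e =>
  /has_adjacent_cat[bu|bv|[u' [x [y [v' [eu ev bxy]]]]]].
- have := IH u szu lu bu; apply:
    (@brspan_ind _ [set t | brspan (dominated w) (lbr t (br v))]).
    exact: subspace_lbrl.
  move=> t [lt' [[st wt']|[pt ht]]] /=.
    apply: lbr_dominated_size => //; first by rewrite e !size_cat ltn_add2r.
    by rewrite e !wt_word_cat leq_add2r.
  apply: lbr_dominated_lyn => //; rewrite ?e; first by rewrite perm_cat2r.
    exact: slt_cat.
  by rewrite -e; apply: slt_catr.
- have := IH v szv lv bv; apply:
    (@brspan_ind _ [set t | brspan (dominated w) (lbr (br u) t)]).
    exact: subspace_lbrr.
  move=> t [lt' [[st wt']|[pt ht]]] /=.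
    apply: lbr_dominated_size => //; first by rewrite e !size_cat ltn_add2l.
    by rewrite e !wt_word_cat leq_add2l.
  apply: lbr_dominated_lyn => //; rewrite ?e; first by rewrite perm_cat2l.
    exact/slt_catl.
  by rewrite -e; apply: slt_catr; apply: (slt_trans ltO wv).
have lyx := redex_lt bxy.
(* The redex straddles: u is the letter x. *)
have [[x' ux]|[u1 [u2 [ee l1 l2 cs']]]] := lyndon_split ltO lu; last first.
  exfalso; have : ~ u2 ≺ v by apply: (@csplit_nlt _ _ ltO u1) => //;
    [rewrite -ee | case: l1].
  apply; have u20 : u2 <> [::] by case: l2.
  have [p e2] : exists p, u2 = rcons p x.
    move: eu; rewrite ee; case/lastP: u2 u20 {l2 cs' ee} => // p z _.
    by rewrite -rcons_cat => /rcons_inj[_ ->]; exists p.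
  rewrite e2 ev; case: p e2 => [|a p] e2; first by left.
  have : u2 ≪ [:: x] by rewrite e2; apply: lyndon_rcons_slt => //; rewrite -e2.
  rewrite e2 /= => -[lxa|[_]]; last by case: (rcons p x).
  by left; case: ltO => _ h _; apply: h lxa.
have xx : x' = x.
  by move: eu; rewrite ux; case: u' => [[]|a [|b u']].
subst x'; clear eu; subst u.
have [[y' vy]|[v1 [v2 [e2 l1 l2 cs2]]]] := lyndon_split ltO lv.
  move: vy; rewrite ev => -[ey ev']; subst y' v'.
  rewrite !(br_letter ltO).
  have := redex_lbr bxy; apply: span_mono => _ [s hs <-].
  exists [:: s]; last by rewrite (br_letter ltO).
  split; first exact: lyndon_letter.
  by left; rewrite e ev /= /wt_word !big_cons !big_nil !addn0.
have [v1' ev1] : exists v1', v1 = y :: v1'.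
  by case: (v1) (proj1 l1) e2 => // a r _; rewrite ev => -[-> _]; exists r.
have v10 : v1 <> [::] by case: l1.
have v20 : v2 <> [::] by case: l2.
have xv1 : [:: x] ≺ v1 by rewrite ev1; left.
have v12 : v1 ≺ v2 by apply: csplit_lt => //; rewrite -e2.
have vv2 : v ≪ v2 by rewrite e2; apply: lyndon_suffix; rewrite -?e2.
have xv2 : [:: x] ≺ v2 by apply: (llt_trans ltO xv1).
have sv1 : (0 < size v1)%N by case: (v1) v10.
have sv2 : (0 < size v2)%N by case: (v2) v20.
have wE : w = x :: v1 ++ v2 by rewrite e e2.
have headv1 t : w ≪ v1 ++ t by rewrite wE ev1; left.
have headv2 t : w ≪ v2 ++ t.
  rewrite wE; move: vv2; rewrite ev; case: (v2) v20 => // h r _ /= [lhy|[<- _]];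
    left => //.
  by case: ltO => _ tr _; apply: tr lhy lyx.
rewrite e2 (br_split ltO gen l1 cs2) lbr_derl; apply: subspaceD => //.
(* [[x,v1],v2]: the leading word x v1 is replaced by induction, and the
     products with v2 stay above w as v2 begins with a letter above x. *)
- have lxv1 : lyn (x :: v1) by apply: (lyndon_cat ltO (lyndon_letter x) l1 xv1).
  have sxv1 : (size (x :: v1) < n)%N.
    by apply: leq_trans sz; rewrite wE /= ltnS size_cat -[X in (X < _)%N]addn0
      ltn_add2l.
  have : brspan (dominated (x :: v1)) (lbr (br [:: x]) (br v1)).
    have := brspan_diff (br_product (lyndon_letter x) l1 xv1).
    apply: brspan_ind; first exact: brspan_sub.
    move=> t [->|[lt' pt ht _]]; last by apply: brspan_in; split=> //; right.
    by apply: IH => //; rewrite /= ev1; left.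
  apply: (@brspan_ind _ [set t | brspan (dominated w) (lbr t (br v2))]).
    exact: subspace_lbrl.
  move=> t [lt' [[st wt']|[pt ht]]] /=.
    apply: lbr_dominated_size => //; rewrite wE -cat_cons;
      first by rewrite !size_cat ltn_add2r.
    by rewrite !wt_word_cat leq_add2r.
  apply: lbr_dominated_lyn => //; rewrite wE -cat_cons;
    first by rewrite perm_cat2r.
  exact: slt_cat.
(* [v1,[x,v2]]: x v2 v1 is above x v1 v2 because v1 v2 is Lyndon. *)
- have := brspan_diff (br_product (lyndon_letter x) l2 xv2).
  apply: (@brspan_ind _ [set t | brspan (dominated w) (lbr (br v1) t)]).
    exact: subspace_lbrr.
  move=> t ht /=.
  have [lt' pt {}ht] : [/\ lyn t,
    perm_eq t (x :: v2) & t = x :: v2 \/ x :: v2 ≪ t].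
    case: ht => [->|[l p h _]]; last by split=> //; right.
    split=> //; last by left.
    exact: (lyndon_cat ltO (lyndon_letter x) l2 xv2).
  apply: lbr_dominated_lyn => //.
    rewrite wE (perm_trans (_ : perm_eq _ (v1 ++ x :: v2))) ?perm_cat2l //.
    by rewrite -cat1s perm_catCA.
  apply: slt_eq_cat ht; rewrite wE cat_cons; right; split=> //.
  by rewrite -e2; apply: slt_catr.
Qed.

Definition reduced n : set (seq S) :=
  [set w | [/\ lyn w, ~ has_adjacent w & (n <= wt_word w)%N]].

(** Domination is followed by induction, on the length first and then, among the
    rearrangements of a given word, along [≪]. *)
Lemma br_reduced w : lyn w -> brspan (reduced (wt_word w)) (br w).
Proof.
have [n] := ubnP (size w); elim: n w => // n IHn w; rewrite ltnS => sz lw.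
suff main z : (size z <= n)%N -> forall w, w \in permutations z -> lyn w ->
    brspan (reduced (wt_word w)) (br w).
  by apply: main sz _ _ lw; rewrite mem_permutations.
move=> {w sz lw} sz; apply: (finite_ind (R := fun a b => b ≪ a)).
- by move=> a; apply: slt_irr.
- by move=> b a c h1 h2; apply: (slt_trans ltO h2).
move=> w; rewrite mem_permutations => pz IH lw.
case: (pselect (has_adjacent w)) => [bw|nb]; last exact: brspan_in.
have := br_has_adjacent lw bw; apply: brspan_ind; first exact: brspan_sub.
move=> t [lt' [[st wt']|[pt ht]]].
  have st' : (size t < n)%N by apply: leq_trans st _; rewrite (perm_size pz).
  have := IHn t st' lt'; apply: brspan_mono => s [ls bs h]; split=> //.
  exact: leq_trans h.
have := IH t; rewrite mem_permutations (perm_trans pt pz) => /(_ isT ht lt').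
by rewrite (wt_word_perm pt).
Qed.

Theorem reduced_lbr n m x y : brspan (reduced n) x -> brspan (reduced m) y ->
  brspan (reduced (n + m)%N) (lbr x y).
Proof.
apply: span_lbr; first exact: brspan_sub.
move=> _ _ [u [lu _ hu] <-] [v [lv _ hv] <-].
have main a b : lyn a -> lyn b -> a ≺ b -> (n + m <= wt_word (a ++ b))%N ->
    brspan (reduced (n + m)%N) (lbr (br a) (br b)).
  move=> la lb ab le; have := brspan_diff (br_product la lb ab).
  apply: brspan_ind; first exact: brspan_sub.
  move=> w hw; have [lw we] : lyn w /\ wt_word w = wt_word (a ++ b).
    by case: hw => [->|[l p _ _]]; split=> //;
      [exact: lyndon_cat | exact: wt_word_perm].
  have := br_reduced lw; rewrite we; apply: brspan_mono => s [ls bs h];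
    split=> //.
  exact: leq_trans h.
have le : (n + m <= wt_word u + wt_word v)%N by apply: leq_add.
have [->|[h|h]] := llt_total ltO u v; first by rewrite lbrxx; apply: span0.
  by apply: main => //; rewrite wt_word_cat.
rewrite lbrC; apply: subspaceN; first exact: brspan_sub.
by apply: main => //; rewrite wt_word_cat (addnC (wt_word v)).
Qed.

End Spanning.

(** * Linear maps defined on a basis or on a quotient *)
Section LinearMaps.
Variable F : fieldType.

Lemma linear_of_fun (U V : lmodType F) (h : U -> V) : linear h ->
  exists H : {linear U -> V}, H =1 h.
Proof.
move=> hlin; pose hL := GRing.isLinear.Build F U V _ h hlin.
by pose H : {linear U -> V} := HB.pack h hL; exists H.
Qed.

Lemma linear_comp (U V W : lmodType F) (g : {linear V -> W})
  (f : {linear U -> V}) :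
  exists H : {linear U -> W}, H =1 g \o f.
Proof. by apply: linear_of_fun => a x y /=; rewrite !linearP. Qed.

Lemma basis_linear_ext (U V : lmodType F) (J : Type) (e : J -> U)
  (f g : U -> V) :
  is_basis e -> linear f -> linear g -> (forall j, f (e j) = g (e j)) -> f =1 g.
Proof.
move=> [_ eT] hf hg h x; have : span (range e) x by rewrite eT.
move: x; apply: (@span_min _ _ _ [set x | f x = g x]);
  last by move=> _ [j _ <-]; apply: h.
have z0 (k : U -> V) : linear k -> k 0 = 0.
  by move=> /linear_of_fun[K hK]; rewrite -hK raddf0.
split; first by rewrite /= !z0.
by move=> a u v /= hu hv; rewrite hf hg hu hv.
Qed.

Section BasisMap.
Variables (U V : lmodType F) (J : Type) (e : J -> U) (m : J -> V).
Hypothesis eb : is_basis e.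

(** [JT] has decidable equality, so that equal indices can be collected. *)
Let JT : choiceType := {classic J}.
Let comb (W : lmodType F) (g : J -> W) (l : seq (F * JT)) : W :=
  \sum_(p <- l) p.1 *: g p.2.

Let comb_zero l : comb e l = 0 -> comb m l = 0.
Proof.
pose s : seq JT := undup [seq (p.2 : JT) | p <- l].
pose coef (k : JT) := \sum_(p <- l | (p.2 : JT) == k) p.1.
have combE (W : lmodType F) (g : J -> W) :
  comb g l = \sum_(k <- s) coef k *: g k.
  under eq_bigr do rewrite scaler_suml.
  symmetry; rewrite (exchange_big_dep xpredT) //= /comb big_seq [RHS]big_seq;
    apply: eq_bigr => p pl.
  have ps : (p.2 : JT) \in s by rewrite mem_undup map_f.
  rewrite big_mkcond (bigD1_seq (p.2 : JT)) ?undup_uniq //= eqxx big1 ?addr0 //.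
  by move=> k /negbTE nk; rewrite eq_sym nk.
have us : uniq s by apply: undup_uniq.
rewrite combE => h0; rewrite combE big_seq big1 // => k ks.
suff -> : coef k = 0 by rewrite scale0r.
have := (proj1 eb) (size s) (tnth (in_tuple s))
  (fun i => coef (tnth (in_tuple s) i)).
rewrite -(big_tnth _ _ s predT (fun k => coef k *: e k)) => h.
have inj : injective (tnth (in_tuple s)).
  by apply/tuple_uniqP.
have ki : (index k s < size s)%N by rewrite index_mem.
by have := h inj h0 (Ordinal ki); rewrite (tnth_nth k) /= nth_index.
Qed.

(** The map is built as its graph, the pairs obtained by evaluating one formal
    combination along [e] and along [m]. The graph is functional because
    collecting equal indices in a combination that vanishes along [e] leaves
    only zero coefficients. *)
Lemma basis_map : exists f : {linear U -> V}, forall j, f (e j) = m j.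
Proof.
pose G v w := exists2 l, v = comb e l & w = comb m l.
have combD (W : lmodType F) (g : J -> W) a l l' :
    comb g ([seq (a * p.1, p.2) | p <- l] ++ l') = a *: comb g l + comb g l'.
  rewrite /comb big_cat big_map scaler_sumr; congr (_ + _).
  by apply: eq_bigr => p _; rewrite scalerA.
have Glin a u u' v v' : G u v -> G u' v' -> G (a *: u + u') (a *: v + v').
  by move=> [l -> ->] [l' -> ->]; exists ([seq (a * p.1, p.2) | p <- l] ++ l');
    rewrite combD.
have Gfun u v v' : G u v -> G u v' -> v = v'.
  move=> h1 h2; have [l] := Glin (-1) _ _ _ _ h1 h2.
  rewrite scaleN1r addNr => /esym/comb_zero -> /eqP.
  by rewrite scaleN1r addrC subr_eq0 => /eqP.
have Gtot u : exists v, G u v.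
  have : span (range e) u by rewrite (proj2 eb).
  move: u; apply: (@span_min _ _ _ [set u | exists v, G u v]).
    split; first by exists 0, [::]; rewrite /comb big_nil.
    by move=> a u u' [v Gv] [v' Gv']; exists (a *: v + v'); apply: Glin.
  move=> _ [j _ <-]; exists (m j), [:: (1, j)];
    by rewrite /comb big_seq1 scale1r.
have [f hf] := choice Gtot.
have [f' hf'] : exists H : {linear U -> V}, H =1 f.
  by apply: linear_of_fun => a u v; apply: Gfun (hf _) _; apply: Glin.
exists f' => j; rewrite hf'; apply: Gfun (hf _) _.
by exists [:: (1, j)]; rewrite /comb big_seq1 scale1r.
Qed.

End BasisMap.

Lemma lie_quot_lift (L M : lieAlgType F) (X : set L) (h : {linear L -> M}) :
  lie_morph h -> (forall x, X x -> h x = 0) ->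
  exists h' : {linear lie_quot X -> M}, lie_morph h' /\ forall x,
    h' (lie_pi X x) = h x.
Proof.
move=> hm hX.
have ker x y : lie_pi X x = lie_pi X y -> h x = h y.
  move/eqP; rewrite -subr_eq0 -raddfB => /eqP/lie_pi_eq0 hxy.
  apply/eqP; rewrite -subr_eq0 -raddfB; apply/eqP.
  apply: (hxy [set x | h x = 0]) => //; split; first split.
  - by rewrite /= raddf0.
  - by move=> a u v /= hu hv; rewrite linearP hu hv scaler0 addr0.
  - by move=> u v /= hv; rewrite hm hv lbr0r.
have [r rK] := choice (@lie_pi_surj _ _ X).
have rP x : h (r (lie_pi X x)) = h x by apply: ker; rewrite rK.
have [H HE] : exists H : {linear lie_quot X -> M}, H =1 (h \o r).
  apply: linear_of_fun => a u v /=; rewrite -[u]rK -[v]rK -linearP !rP.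
  by rewrite linearP.
exists H; split=> [u v|x]; rewrite !HE //=.
by rewrite -[u]rK -[v]rK -lie_pi_lbr !rP hm.
Qed.

Lemma lie_morph_basis (L M : lieAlgType F) (J : Type) (e : J -> L)
  (f : {linear L -> M}) :
  is_basis e -> (forall i j, f (lbr (e i) (e j)) = lbr (f (e i)) (f (e j))) ->
  lie_morph f.
Proof.
move=> eb h x y.
apply: (basis_linear_ext (f := fun y => f (lbr x y))
  (g := fun y => lbr (f x) (f y)) eb).
- by move=> a u v; rewrite lbr_linearr linearP.
- by move=> a u v; rewrite linearP lbr_linearr.
move=> j; apply: (basis_linear_ext (f := fun x => f (lbr x (e j)))
  (g := fun x => lbr (f x) (f (e j))) eb) => // a u v;
    first by rewrite lbr_linearl linearP.
by rewrite linearP lbr_linearl.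
Qed.

End LinearMaps.

(** * Levels in a Lazard Lie algebra *)
Section Levels.
Variables (F : fieldType) (c : nat) (L : LLA F c).
Hypothesis hc : (0 < c)%N.
Implicit Types (x : L).

Let LA := LLA_axioms L.

Lemma lev_ge i x : (0 < i <= c)%N -> dist L i x -> (i <= lev c x)%N.
Proof.
move=> ic hi; rewrite /lev; apply: (@leq_bigmax_seq _ _ _ id);
  last exact/asboolP.
by rewrite mem_index_iota ltnS.
Qed.

Lemma lev_gt0 x : (0 < lev c x)%N.
Proof. by apply: lev_ge; [rewrite hc | rewrite (dist1 LA)]. Qed.

Lemma dist_lev x : dist L (lev c x) x.
Proof.
have : (lev c x = 0)%N \/ dist L (lev c x) x; last first.
  by case=> // e; have := lev_gt0 x; rewrite e.
rewrite /lev; elim/big_ind: _ => [|m n hm hn|i /asboolP];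
  [by left | | by right].
by case: (leqP m n).
Qed.

Lemma dist_mono i j x : (0 < i <= j)%N -> dist L j x -> dist L i x.
Proof.
case/andP=> i0 /subnK <-; elim: (j - i)%N => // n IH h; apply: IH.
by apply: (dist_desc LA) => //; rewrite addn_gt0 i0 orbT.
Qed.

(** A basis vector is nonzero, so it lies in [dist L i] only for [i <= c], the
    range over which [lev] takes its maximum. *)
Lemma lev_basis_ge (J : Type) (e : J -> L) i j : is_basis e -> (0 < i)%N ->
  dist L i (e j) -> (i <= lev c (e j))%N.
Proof.
move=> [ei _] i0; case: (leqP i c) => ic; first by apply: lev_ge; rewrite i0.
rewrite (dist_nil LA) // => /= e0.
have inj : injective (fun _ : 'I_1 => j) by move=> a b _; rewrite !ord1.
have := ei 1%N (fun=> j) (fun=> 1) inj; rewrite big_ord1 e0 scaler0.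
by move=> /(_ erefl ord0)/eqP; rewrite oner_eq0.
Qed.

End Levels.

(** * The construction *)
Section Construction.
Variables (F : fieldType) (c : nat) (I : Type) (L : I -> LLA F c).
Variables (Ls : LLA F c) (iota : forall a, {linear Ls -> L a}).
Hypothesis hc : (0 < c)%N.
Hypothesis iota_emb : forall a, LLA_emb (iota a).
Variable X : choices iota.

Local Notation letterT := ({classic letter X} : eqType).

(** The inductive order on letters by cases, with an explicit transport between
    the types [cK X a], which is easier to invert. *)
Definition lt_letter_cases (p q : letter X) : Prop :=
  match p, q with
  | inl j, inl j' => ltJ j j'
  | inl _, inr _ => True
  | inr _, inl _ => False
  | inr (existT a k), inr (existT a' k') =>
      ltI X a a' \/ exists e : a = a', ltK (eq_rect a (cK X) k a' e) k'
  end.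

Lemma lt_letterE p q : lt_letter p q <-> lt_letter_cases p q.
Proof.
split; first by case=> // [a a' k k' h|a k k' h]; [left | right; exists erefl].
case: p q => [j|[a k]] [j'|[a' k']] //=; try by constructor.
by case=> [h|[e]]; [constructor | case: a' / e k' => k' h; constructor].
Qed.

Lemma lt_letter_total : strict_total_order (@lt_letter _ _ _ _ _ _ X).
Proof.
have [Jirr Jtr Jtot] := ltJ_total X.
have [Iirr Itr Itot] := ltI_total X.
split.
- move=> [j|[a k]] /lt_letterE /=; first exact: Jirr.
  have [Kirr _ _] := ltK_total X a.
  by case=> [/Iirr//|[e]]; rewrite (Prop_irrelevance e erefl) /=; apply: Kirr.
- move=> [j|[a k]] [j'|[a' k']] [j''|[a'' k'']] /lt_letterE /= h /lt_letterE /=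
    h';
    apply/lt_letterE => //=; first exact: Jtr h h'.
  have [_ Ktr _] := ltK_total X a''.
  case: h h' => [h|[e h]] [h'|[e' h']].
  + by left; apply: Itr h h'.
  + by left; rewrite -e'.
  + by left; rewrite e.
  + right; case: a'' / e' k'' h' Ktr => k'' /= h' Ktr.
    case: a' / e k' k'' h h' Ktr => k' k'' /= h h' Ktr.
    by exists erefl; apply: Ktr h h'.
- move=> [j|[a k]] [j'|[a' k']] ne.
  + case: (Jtot j j'); first by move=> e; apply: ne; rewrite e.
      by left; constructor.
    by right; constructor.
  + by left; constructor.
  + by right; constructor.
  + have [e|ne'] := pselect (a = a'); last first.
      by case: (Itot _ _ ne'); [left | right]; constructor.
    case: a' / e k' ne => k' ne.
    have [_ _ Ktot] := ltK_total X a.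
    case: (Ktot k k'); first by move=> e; apply: ne; rewrite e.
      by left; constructor.
    by right; constructor.
Qed.

Lemma lt_fsym a (b b' : idx X a) : lt_idx b b' -> lt_letter (fsym b) (fsym b').
Proof. by case=> *; constructor. Qed.

Lemma lt_idx_total a (b b' : idx X a) : b = b' \/ lt_idx b b' \/ lt_idx b' b.
Proof.
have [_ _ Jtot] := ltJ_total X; have [_ _ Ktot] := ltK_total X a.
case: (pselect (b = b')) => [|ne]; [by left | right].
case: b b' ne => [j|k] [j'|k'] ne.
- case: (Jtot j j'); first by move=> e; apply: ne; rewrite e.
    by left; constructor.
  by right; constructor.
- by left; constructor.
- by right; constructor.
- case: (Ktot k k'); first by move=> e; apply: ne; rewrite e.
    by left; constructor.
  by right; constructor.
Qed.

Definition gen_LbarQ (s : letter X) : LbarQ X :=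
  lie_pi (@Qrel _ _ _ _ _ _ X) (free_gen F s).

(** The adjacent pairs excluded from special words. *)
Definition descent (x y : letter X) : Prop :=
  exists a (b b' : idx X a), [/\ x = fsym b, y = fsym b' & lt_idx b' b].

Lemma descent_lt x y : descent x y -> lt_letter y x.
Proof. by case=> a [b [b' [-> -> /lt_fsym]]]. Qed.

Lemma lev_fsym a (b : idx X a) : lev_letter (fsym b) = lev c (ebase b).
Proof. by case: b => [j|k] //=; rewrite lev_emb. Qed.

(** The relations [Qrel] say precisely that the map is multiplicative on pairs
    of basis vectors in increasing order. *)
Lemma morph_to_LbarQ a : exists f : {linear L a -> LbarQ X},
  lie_morph f /\ forall b : idx X a, f (ebase b) = gen_LbarQ (fsym b).
Proof.
have [eb _] := e_malcev X a.
have [f hf] := basis_map (fun b : idx X a => gen_LbarQ (fsym b)) eb.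
exists f; split=> //; apply: (lie_morph_basis eb).
have main (b g : idx X a) : lt_idx b g ->
  f (lbr (ebase b) (ebase g)) = lbr (f (ebase b)) (f (ebase g)).
  move=> bg; have : span (range (@ebase _ _ _ _ _ _ X a))
    (lbr (ebase b) (ebase g)) by rewrite (proj2 eb).
  case=> n [lam [x [hx e]]].
  have /choice[d hd] : forall i, exists d : idx X a, ebase d = x i.
    by move=> i; have [d _ <-] := hx i; exists d.
  have {}e : lbr (ebase b) (ebase g) = \sum_i lam i *: ebase (d i).
    by rewrite e; apply: eq_bigr => i _; rewrite hd.
  have /lie_pi_eq0 := sub_ideal_gen (QRel bg e).
  rewrite raddfB /= lie_pi_lbr raddf_sum => /eqP; rewrite subr_eq0 => /eqP q.
  rewrite !hf [RHS]q e linear_sum; apply: eq_bigr => i _.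
  by rewrite linearZ hf [RHS]linearZ.
move=> b g; have [<-|[h|h]] := lt_idx_total b g.
- by rewrite !lbrxx raddf0.
- exact: main.
- by rewrite lbrC raddfN [RHS]lbrC -(main _ _ h).
Qed.

(** By the Malcev property, only basis vectors of level at least [i] occur in an
    element of [dist (L a) i]. *)
Lemma morph_to_LbarQ_dist a (f : {linear L a -> LbarQ X}) i x :
  (forall b : idx X a, f (ebase b) = gen_LbarQ (fsym b)) -> (0 < i)%N ->
    dist (L a) i x ->
  span (gen_LbarQ @` [set s | (i <= lev_letter s)%N]) (f x).
Proof.
move=> hf i0; have [eb ed] := e_malcev X a; rewrite ed //.
apply: (@span_min _ _ _ [set x | span
  (gen_LbarQ @` [set s | (i <= lev_letter s)%N]) (f x)]).
  split=> [|k u v hu hv]; rewrite /= ?raddf0 ?linearP; first exact: span0.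
  by have [_] := span_subspace (gen_LbarQ @` [set s | (i <= lev_letter s)%N]);
    apply.
move=> _ [[b _ <-] hb] /=; rewrite hf; apply: sub_span; exists (fsym b) => //=.
by rewrite lev_fsym; apply: lev_basis_ge hb.
Qed.

(** The bracket is the image of the bracket of two basis vectors of one [L a],
    which lies in the distinguished subalgebra indexed by the sum of levels. *)
Lemma descent_lbr x y : descent x y ->
  span (gen_LbarQ @` [set s | (lev_letter x + lev_letter y <= lev_letter s)%N])
    (lbr (gen_LbarQ x) (gen_LbarQ y)).
Proof.
case=> a [b [b' [-> -> _]]].
have [f [fm hf]] := morph_to_LbarQ a.
rewrite -!hf -fm !lev_fsym; apply: morph_to_LbarQ_dist => //;
  first by rewrite addn_gt0 lev_gt0.
by apply: (dist_lbr (LLA_axioms (L a))); rewrite ?lev_gt0 //; apply: dist_lev.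
Qed.

Lemma specialE w : special w <->
  lyndon (@lt_letter _ _ _ _ _ _ X) w /\ ~ has_adjacent descent w.
Proof.
split=> [[/(regularE lt_letter_total) lw h]|[/(regularE lt_letter_total) lw h]];
  split=> //.
  move=> /has_adjacentP[u [x [y [v [e [a [b [b' [ex ey hb]]]]]]]]].
  by apply: (h a b b' u v) hb; rewrite e ex ey.
move=> a b b' u v e hb; apply: h; apply/has_adjacentP.
by exists u, (fsym b), (fsym b'), v; split=> //; exists a, b, b'.
Qed.

Local Notation reduced :=
  (reduced (S := {classic letter X}) (@lt_letter _ _ _ _ _ _ X)
  (@lev_letter _ _ _ _ _ _ X) descent).

(** Evaluating a bracketing in the free Lie algebra and then projecting is the
    same as evaluating it in the quotient, where the rewriting takes place. *)
Lemma PQE i : PQ X i = brspan (S := {classic letter X})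
  (@lt_letter _ _ _ _ _ _ X) gen_LbarQ (reduced i).
Proof.
have pm : lie_morph (lie_pi (@Qrel _ _ _ _ _ _ X)) by apply: lie_pi_lbr.
rewrite /PQ /brspan; congr span; apply/seteqP; split=> y.
  case=> w [x [/specialE[lw nb] iw bw ->]]; exists w; first by split.
  by apply/(brP lt_letter_total); apply: (bracketing_morph pm bw).
case=> w [lw nb iw] <-.
have [x bx ->] := bracketing_morph_inv pm
  (lyndon_bracketing lt_letter_total gen_LbarQ lw).
by exists w, x; split=> //; apply/specialE.
Qed.

Lemma PQ_sub i : subspace (PQ X i). Proof. exact: span_subspace. Qed.

Lemma PQ_mono i j : (i <= j)%N -> PQ X j `<=` PQ X i.
Proof.
move=> ij; apply: span_mono => _ [w [x [sw jw bw ->]]]; exists w, x; split=> //.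
exact: leq_trans jw.
Qed.

Lemma PQ_lbr i j x y : PQ X i x -> PQ X j y -> PQ X (i + j)%N (lbr x y).
Proof.
rewrite !PQE; apply: (@reduced_lbr _ _ {classic letter X});
  [exact: lt_letter_total | exact: descent_lt | exact: descent_lbr].
Qed.

Lemma PQ_letter s : PQ X (lev_letter s) (gen_LbarQ s).
Proof.
apply: sub_span; exists [:: s], (free_gen F s); split=> //;
  last exact: BrLetter.
- apply/specialE; split; first exact: lyndon_letter.
  by case.
- by rewrite /lev_word big_seq1.
Qed.

Lemma lev_letter_gt0 (s : letter X) : (0 < lev_letter s)%N.
Proof. by case: s => [j|[a k]]; apply: lev_gt0. Qed.

Lemma PQ1 : PQ X 1 = setT.
Proof.
apply/seteqP; split=> // q _; have [x <-] := lie_pi_surj q.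
have S1 := PQ_sub 1.
rewrite -[x](@lsq_reprK _ (lterm_setoid F (letter X)));
  elim: (lsq_repr x) => /=.
- by move=> s; apply: (PQ_mono (lev_letter_gt0 s)); apply: PQ_letter.
- by rewrite lsq_pi0 raddf0; case: S1.
- by move=> t ht; rewrite lsq_piN raddfN; apply: subspaceN.
- by move=> t ht u hu; rewrite lsq_piD raddfD; apply: subspaceD.
- by move=> a t ht; rewrite lsq_piZ linearZ; apply: subspaceZ.
- move=> t ht u hu; rewrite lsq_pi_lbr lie_pi_lbr.
  exact: (PQ_mono (leqnSn 1)) (PQ_lbr ht hu).
Qed.

Lemma PQ_ideal i : lie_ideal (PQ X i).
Proof.
split; first exact: PQ_sub.
move=> x y hy; apply: (PQ_mono (leq_addl 1 i)); apply: PQ_lbr => //.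
by rewrite PQ1.
Qed.

Local Notation proj := (@lie_pi F (LbarQ X) (PQ X c.+1)).

Lemma proj_eq0 x : proj x = 0 <-> PQ X c.+1 x.
Proof. by rewrite lie_pi_eq0 ideal_gen_id //; apply: PQ_ideal. Qed.

Lemma proj_lbr : lie_morph proj. Proof. exact: lie_pi_lbr. Qed.

(** Everything above level [c] vanishes since [PQ X c.+1] is an ideal and so is
    the whole kernel of the projection. *)
Lemma Lprime_LLA : is_LLA c (Lprime X).
Proof.
have sub i : subspace (proj @` PQ X i).
  have [h0 hl] := PQ_sub i; split; first by exists 0 => //; rewrite raddf0.
  by move=> a _ _ [u hu <-] [v hv <-]; exists (a *: u + v);
    [apply: hl | rewrite linearP].
have lbrP i j x y : (proj @` PQ X i) x -> (proj @` PQ X j) y ->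
  (proj @` PQ X (i + j)%N) (lbr x y).
  move=> [u hu <-] [v hv <-]; exists (lbr u v); last exact: proj_lbr.
  exact: PQ_lbr.
have mono i j : (i <= j)%N -> proj @` PQ X j `<=` proj @` PQ X i.
  by move=> ij _ [u hu <-]; exists u => //; apply: PQ_mono hu.
split.
- move=> i i0; split; first exact: sub.
  by move=> x y hx hy; apply: (mono _ _ (leq_addr i i)); apply: lbrP.
- apply/seteqP; split=> // q _; have [x <-] := lie_pi_surj q; exists x => //.
  by rewrite PQ1.
- by move=> i _; apply: mono.
- by move=> i j x y _ _; apply: lbrP.
- move=> k ck; apply/seteqP; split=> [_ [u hu <-]|_ ->]; last by case: (sub k).
  by apply/proj_eq0; apply: PQ_mono hu.
Qed.

Definition LprimeLLA : LLA F c := MkLLA Lprime_LLA.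

Definition gen_Lprime (s : letter X) : Lprime X := proj (gen_LbarQ s).

Lemma hom_to_Lprime a : exists f : {linear L a -> Lprime X},
  LLA_hom f /\ forall b : idx X a, f (ebase b) = gen_Lprime (fsym b).
Proof.
have [f [fm hf]] := morph_to_LbarQ a.
have [g hg] := linear_comp proj f.
exists g; split; last by move=> b; rewrite hg /= hf.
split=> [x y|i x i0 hx]; first by rewrite !hg /= fm proj_lbr.
exists (f x); last by rewrite hg.
have := morph_to_LbarQ_dist hf i0 hx; apply: span_min; first exact: PQ_sub.
by move=> _ [s hs <-]; apply: PQ_mono (PQ_letter s).
Qed.

(** Both maps are determined by their pullbacks to the free Lie algebra. *)
Lemma Lprime_ext (M : lieAlgType F) (f g : {linear Lprime X -> M}) :
  lie_morph f -> lie_morph g ->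
    (forall s, f (gen_Lprime s) = g (gen_Lprime s)) -> f =1 g.
Proof.
move=> fm gm fg.
have [H [Hm Hs Hu]] := free_lie_universal (fun s => f (gen_Lprime s)).
have [p hp] := linear_comp proj (@lie_pi F (Lbar X) (@Qrel _ _ _ _ _ _ X)).
have pm : lie_morph p by move=> x y; rewrite !hp /= lie_pi_lbr proj_lbr.
have aux (h : {linear Lprime X -> M}) : lie_morph h ->
    (forall s, h (gen_Lprime s) = f (gen_Lprime s)) -> forall x, h (p x) = H x.
  move=> hm hs x; have [k hk] := linear_comp h p.
  rewrite -[LHS]/((h \o p) x) -hk; apply: Hu => [u v|s].
    by rewrite !hk /= pm hm.
  by rewrite hk /= hp -hs.
move=> q; have [y <-] := lie_pi_surj q; have [x <-] := lie_pi_surj y.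
by rewrite -[proj _]hp !aux.
Qed.

(** Extend the assignment letter to basis vector to the free Lie algebra. It
    kills [Qrel] because the [f a] are morphisms. A bracketing of [w] goes to
    level [lev_word w] of [D], so [PQ X i] goes to [dist D i]; in particular
    [PQ X c.+1] goes to [0]. The map [fs] prescribes the images of the letters
    shared by all the [L a]. *)
Lemma Lprime_universal (D : LLA F c) (fs : {linear Ls -> D})
  (f : forall a, {linear L a -> D}) :
  LLA_hom fs -> (forall a, LLA_hom (f a)) ->
    (forall a x, f a (iota a x) = fs x) ->
  exists h : {linear Lprime X -> D}, LLA_hom h /\
    forall a (b : idx X a), h (gen_Lprime (fsym b)) = f a (ebase b).
Proof.
move=> fsh fh compat.
pose psi (s : letter X) : D := match s with
  | inl j => fs (eJ j) | inr (existT a k) => f a (eK k) end.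
have psiE a (b : idx X a) : psi (fsym b) = f a (ebase b).
  by case: b => [j|k] //=; rewrite compat.
have [h0 [h0m h0s _]] := free_lie_universal psi.
have [|h1 [h1m h1E]] := @lie_quot_lift _ _ _ (@Qrel _ _ _ _ _ _ X) h0 h0m.
  move=> _ [a b g n lam d _ e].
  rewrite raddfB /= h0m /fbar !h0s !psiE -(proj1 (fh a)) e.
  apply/eqP; rewrite subr_eq0 !linear_sum; apply/eqP; apply: eq_bigr => i _.
  by rewrite !linearZ /= h0s psiE.
have h1dist i x : (0 < i)%N -> PQ X i x -> dist D i (h1 x).
  move=> i0; have [[d0 dl] _] := dist_subalg (LLA_axioms D) i0.
  apply: (@span_min _ _ _ [set x | dist D i (h1 x)]).
    split=> [|a u v hu hv]; rewrite /= ?raddf0 ?linearP //; exact: dl.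
  move=> _ [w [y [_ iw bw ->]]] /=; rewrite h1E.
  apply: dist_mono (_ : dist D (lev_word w) _); first by rewrite i0.
  suff [] : (0 < lev_word w)%N /\ dist D (lev_word w) (h0 y) by [].
  elim: bw => [s|u v x' y' _ _ [u0 hu] _ [v0 hv]].
    rewrite /lev_word big_seq1 lev_letter_gt0 h0s; split=> //.
    case: s => [j|[a k]] /=; first by apply: (proj2 fsh);
      [apply: lev_gt0 | apply: dist_lev].
    by apply: (proj2 (fh a)); [apply: lev_gt0 | apply: dist_lev].
  have -> : h0 (lbr x' y') = lbr (h0 x') (h0 y') by apply: h0m.
  rewrite /lev_word big_cat /= addn_gt0; split;
    first by rewrite [X in X || _]u0.
  exact: (dist_lbr (LLA_axioms D)).
have [|h2 [h2m h2E]] := @lie_quot_lift _ _ _ (PQ X c.+1) h1 h1m.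
  by move=> x /h1dist; rewrite (dist_nil (LLA_axioms D)) //; apply.
exists h2; split; last by move=> a b; rewrite h2E h1E h0s psiE.
by split=> // i _ i0 [x hx <-]; rewrite h2E; apply: h1dist.
Qed.

End Construction.

(** * Comparison with the free amalgam *)
Theorem lemma3p7 (c : nat) (hc : (1 <= c)%N) (F : fieldType) (A B C : LLA F c)
    (f0 : {linear C -> A}) (g0 : {linear C -> B})
    (hf0 : LLA_emb f0) (hg0 : LLA_emb g0)
    (X : choices (pair_incl f0 g0)) :
  [/\ lie_ideal (PQ X c.+1),
      is_LLA c (Lprime X)
    & forall T : LLA F c, is_free_amalgam f0 g0 T -> LLA_iso (Lprime X) T].
Proof.
have emb a : LLA_emb (pair_incl f0 g0 a) by case: a.
split; [exact: PQ_ideal | exact: Lprime_LLA |].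
move=> T [f1 [g1 [[[f1m f1i f1d] [g1m g1i g1d] fg] _ _ univ]]].
have f1h : LLA_hom f1 by split=> // i x i0 /(f1d _ _ i0).
have g1h : LLA_hom g1 by split=> // i x i0 /(g1d _ _ i0).
have [fs hfs] := linear_comp f1 f0.
have fsh : LLA_hom fs.
  have [f0m _ f0d] := hf0; split=> [x y|i x i0 hx];
    first by rewrite !hfs /= f0m f1m.
  by rewrite hfs; apply/(f1d _ _ i0)/(f0d _ _ i0).
pose Fm a : {linear pair_fam A B a -> T} :=
  match a with true => g1 | false => f1 end.
have Fh a : LLA_hom (Fm a) by case: a.
have Fc a x : Fm a (pair_incl f0 g0 a x) = fs x.
  by case: a; rewrite hfs //= -fg.
have [k [[km kd] kE]] := Lprime_universal hc X fsh Fh Fc.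
have [iA [iAh iAE]] := hom_to_Lprime emb X false.
have [iB [iBh iBE]] := hom_to_Lprime emb X true.
have glue x : iA (f0 x) = iB (g0 x).
  apply: (basis_linear_ext (f := iA \o f0) (g := iB \o g0)
    (proj1 (eJ_malcev X))) => [a u v|a u v|j] /=.
  - by rewrite !linearP.
  - by rewrite !linearP.
  - exact: (etrans (iAE (inl j)) (esym (iBE (inl j)))).
have [h [[hm hd] hA hB _]] := univ (LprimeLLA hc emb X) iA iB iAh iBh glue.
have kA x : k (iA x) = f1 x.
  have eb := proj1 (e_malcev X false).
  apply: (basis_linear_ext (f := k \o iA) (g := f1) eb) => [a u v|a u v|b] /=;
    rewrite ?linearP //.
  by rewrite -[RHS](kE false b) -(iAE b).
have kB x : k (iB x) = g1 x.
  have eb := proj1 (e_malcev X true).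
  apply: (basis_linear_ext (f := k \o iB) (g := g1) eb) => [a u v|a u v|b] /=;
    rewrite ?linearP //.
  by rewrite -[RHS](kE true b) -(iBE b).
have kh x : k (h x) = x.
  have [H [_ _ _ uniq]] := univ T f1 g1 f1h g1h fg.
  have [kh khE] := linear_comp k h.
  rewrite -[LHS]khE uniq; last 3 first.
  - split=> [u v|i u i0 hu]; first by rewrite !khE /= hm km.
    by rewrite khE; apply: kd => //; apply: hd.
  - by move=> u; rewrite khE /= hA kA.
  - by move=> u; rewrite khE /= hB kB.
  by rewrite -(uniq (@idfun T)) //.
have hk x : h (k x) = x.
  have [hk hkE] := linear_comp h k.
  rewrite -[LHS]hkE.
  apply: (Lprime_ext (f := hk) (g := (@idfun (Lprime X)))) => // [u v|s];
    first by rewrite !hkE /= km hm.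
  rewrite hkE /=; case: s => [j|[[] b]].
  - rewrite (kE false (inl j)); exact: (etrans (hA _) (iAE (inl j))).
  - rewrite (kE true (inr b)); exact: (etrans (hB _) (iBE (inr b))).
  - rewrite (kE false (inr b)); exact: (etrans (hA _) (iAE (inr b))).
exists k; split; last by exists h.
split=> // [x y e|i x i0]; first by rewrite -(hk x) e hk.
by split=> [/kd|/hd]; [apply | rewrite hk; apply].
Qed.
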